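(* Let $\theta$ be a non-constant inner function. The linear maps $D_T,D_H:\mathcal{B}(\mathcal{K}_\theta)\to\mathcal{B}(\mathcal{K}_\theta)$ given by $$D_T(X)=X-S_\theta XS_\theta^*,\qquad D_H(X)=X-S_\theta^*XS_\theta^*$$ are both injective on $\mathcal{B}(\mathcal{K}_\theta)$.
   Context: $H^2\subset L^2(\mathbb{T})$ is the Hardy space of the unit circle. An inner function $\theta$ is a bounded analytic function on the unit disk with $|\theta|=1$ a.e. on $\mathbb{T}$. The model space is $\mathcal{K}_\theta=H^2\ominus\theta H^2$, $P_{\mathcal{K}_\theta}$ is the orthogonal projection of $L^2(\mathbb{T})$ onto $\mathcal{K}_\theta$, the compressed shift is $S_\theta f=P_{\mathcal{K}_\theta}(zf)$ for $f\in\mathcal{K}_\theta$, and $\mathcal{B}(\mathcal{K}_\theta)$ is the algebra of bounded linear operators on $\mathcal{K}_\theta$. *)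

(* Defs.v *)
From HB Require Import structures.
From mathcomp Require Import all_boot all_order all_algebra ring_quotient.
From mathcomp Require Import sesquilinear.
From mathcomp Require Import all_classical all_reals all_analysis.
From mathcomp Require Import measurable_realfun complex.
From mathcomp Require Import ring lra.

Set Implicit Arguments.
Unset Strict Implicit.
Unset Printing Implicit Defensive.

Import Order.TTheory GRing.Theory Num.Theory.
Import numFieldNormedType.Exports.

Local Open Scope classical_set_scope.
Local Open Scope ring_scope.
Local Open Scope quotient_scope.
Local Open Scope complex_scope.

Section circle.
Variable R : realType.

Fact two_pi_gt0 : 0 < 2 * pi :> R.
Proof. by rewrite mulr_gt0// pi_gt0. Qed.

(* Functions on the unit circle are written in the coordinate t of the point
   e^{it}: they are functions of t : R, taken up to equality almost everywhere
   for the normalized arc length below, hence only t in [0, 2 pi] matters. *)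
Definition circle_measure : set (measurableTypeR R) -> \bar R :=
  uniform_prob two_pi_gt0.
HB.instance Definition _ := Probability.on circle_measure.

Definition expi (t : R) : R[i] := cos t +i* sin t.

Local Notation mu := circle_measure.

Lemma circle_aeS (P Q : R -> Prop) : (forall t, P t -> Q t) ->
  {ae mu, forall t, P t} -> {ae mu, forall t, Q t}.
Proof.
have F : Filter (almost_everywhere mu) by apply: ae_filter_ringOfSetsType.
by move=> PQ; apply: (filterS (F := almost_everywhere mu)).
Qed.

Lemma circle_aeS2 (P Q S : R -> Prop) : (forall t, P t -> Q t -> S t) ->
  {ae mu, forall t, P t} -> {ae mu, forall t, Q t} -> {ae mu, forall t, S t}.
Proof.
have F : Filter (almost_everywhere mu) by apply: ae_filter_ringOfSetsType.
by move=> h; apply: (filterS2 F).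
Qed.

Definition L2pred : {pred (R -> R[i])} :=
  [pred f | (((@complex.Re R \o f) : measurableTypeR R -> R) \in Lfun mu 2%:E) &&
            (((@complex.Im R \o f) : measurableTypeR R -> R) \in Lfun mu 2%:E)].

Lemma L2predP (f : R -> R[i]) : reflect
  (((@complex.Re R \o f) : measurableTypeR R -> R) \in Lfun mu 2%:E /\
   ((@complex.Im R \o f) : measurableTypeR R -> R) \in Lfun mu 2%:E)
  (f \in L2pred).
Proof. exact: andP. Qed.

Lemma L2pred_submod_closed : submod_closed L2pred.
Proof.
have p1 : (1 <= 2%:E :> \bar R)%E by rewrite lee_fin ler1n.
have [L0 LD] := Lfun_submod_closed mu p1.
split; first by apply/L2predP; split; exact: L0.
move=> [a b] f g /L2predP[f1 f2] /L2predP[g1 g2]; apply/L2predP; split.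
  have -> : @complex.Re R \o ((a +i* b) *: f + g) =
     a *: (@complex.Re R \o f) + ((- b) *: (@complex.Im R \o f) + (@complex.Re R \o g)).
    apply/funext => x; rewrite !fctE/=; case: (f x) (g x) => [u v] [u' v'] /=.
    by rewrite /GRing.scale/=; ring.
  by apply: (LD) => //; apply: (LD).
have -> : @complex.Im R \o ((a +i* b) *: f + g) =
   a *: (@complex.Im R \o f) + (b *: (@complex.Re R \o f) + (@complex.Im R \o g)).
  apply/funext => x; rewrite !fctE/=; case: (f x) (g x) => [u v] [u' v'] /=.
  by rewrite /GRing.scale/=; ring.
by apply: (LD) => //; apply: (LD).
Qed.

HB.instance Definition _ := GRing.isSubmodClosed.Build _ _ L2pred
  L2pred_submod_closed.

Record L2fun := MkL2fun {
  L2fun_val :> R -> R[i];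
  _ : L2fun_val \in L2pred }.
HB.instance Definition _ := [isSub for L2fun_val].
HB.instance Definition _ := [Choice of L2fun by <:].
HB.instance Definition _ := [SubChoice_isSubLmodule of L2fun by <:].

Definition L2null : {pred L2fun} :=
  [pred f : L2fun | `[< {ae mu, forall t, f t = 0} >]].

Lemma L2nullP (f : L2fun) : f \in L2null <-> {ae mu, forall t, f t = 0}.
Proof. by split => [/asboolW|/asboolT]. Qed.

Lemma L2null_submod_closed : submod_closed L2null.
Proof.
split; first by apply/L2nullP; exact: aeW.
move=> a f g /L2nullP f0 /L2nullP g0; apply/L2nullP.
move: f0 g0; apply: circle_aeS2 => t; rewrite /= !fctE => -> ->.
by rewrite scaler0 addr0.
Qed.

HB.instance Definition _ := GRing.isSubmodClosed.Build _ _ L2null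
  L2null_submod_closed.

(* L^2(T), complex-valued: square-integrable functions modulo null functions *)
Definition L2 : Type := {ideal_quot (GRing.ZmodClosed.clone _ L2null _)}.
HB.instance Definition _ := GRing.Zmodule.on L2.
HB.instance Definition _ := EqQuotient.on L2.

Definition L2class (f : L2fun) : L2 := \pi_L2 f.

Coercion L2repr (f : L2) : L2fun := repr f.

Lemma L2reprK (f : L2) : L2class f = f.
Proof. exact: reprK. Qed.

Lemma L2classP (f g : L2fun) :
  L2class f = L2class g <-> {ae mu, forall t, f t = g t}.
Proof.
have E : (\pi_L2 f == \pi_L2 g) = (f - g \in L2null).
  by rewrite Quotient.idealrBE.
split.
  move=> /eqP; rewrite E => /L2nullP; apply: circle_aeS => t /=.
  by move=> /eqP; rewrite subr_eq0 => /eqP.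
move=> h; apply/eqP; rewrite E; apply/L2nullP.
move: h; apply: circle_aeS => t /= fg.
by rewrite [LHS](_ : _ = f t - g t)// fg subrr.
Qed.

Lemma L2classE (f : L2fun) : {ae mu, forall t, L2class f t = f t}.
Proof. exact/L2classP/L2reprK. Qed.

Lemma L2eqP (f g : L2) : f = g <-> {ae mu, forall t, f t = g t}.
Proof. by rewrite -L2classP !L2reprK. Qed.

Lemma L2classD f g : L2class (f + g) = L2class f + L2class g.
Proof. exact: Quotient.pi_add. Qed.

Lemma L2class0 : L2class 0 = 0.
Proof. by apply: (addrI (L2class 0)); rewrite -L2classD !addr0. Qed.

Definition L2scale (a : R[i]) (f : L2) : L2 := L2class (a *: L2repr f).

Lemma L2class_scale a f : L2scale a (L2class f) = L2class (a *: f).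
Proof.
apply/L2classP; have := L2classE f; apply: circle_aeS => t /=.
by rewrite !fctE => ->.
Qed.

Fact L2scaleA a b f : L2scale a (L2scale b f) = L2scale (a * b) f.
Proof. by rewrite -[f]L2reprK !L2class_scale scalerA. Qed.
Fact L2scale1 : left_id 1 L2scale.
Proof. by move=> f; rewrite -[f]L2reprK L2class_scale scale1r. Qed.
Fact L2scaleDr : right_distributive L2scale +%R.
Proof.
move=> a f g; rewrite -[f]L2reprK -[g]L2reprK -L2classD !L2class_scale.
by rewrite scalerDr L2classD.
Qed.
Fact L2scaleDl f : {morph L2scale^~ f : a b / a + b}.
Proof.
by move=> a b; rewrite -[f]L2reprK !L2class_scale scalerDl L2classD.
Qed.
HB.instance Definition _ := GRing.Zmodule_isLmodule.Build R[i] L2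
  L2scaleA L2scale1 L2scaleDr L2scaleDl.

Lemma L2addE (f g : L2) : {ae mu, forall t, (f + g : L2) t = f t + g t}.
Proof.
have -> : f + g = L2class (L2repr f + L2repr g) by rewrite L2classD !L2reprK.
exact: L2classE.
Qed.

Lemma L2scaleE a (f : L2) : {ae mu, forall t, (a *: f : L2) t = a * f t}.
Proof. exact: L2classE (a *: L2repr f). Qed.

Lemma Lfun2_mul_bounded (b g : measurableTypeR R -> R) :
  measurable_fun setT b -> (forall t, `|b t| <= 1) ->
  g \in Lfun mu 2%:E -> (b \* g : measurableTypeR R -> R) \in Lfun mu 2%:E.
Proof.
move=> mb b1 /andP[/[!inE]/= mg fg]; apply/andP; split; rewrite inE/=.
  by apply: measurable_funM.
have mc (k : measurableTypeR R -> R) : measurable_fun setT k ->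
    measurable_fun setT (fun x => (`|k x| `^ 2)%:E).
  move=> mk; apply/measurable_EFinP.
  apply/(@measurableT_comp _ _ _ _ _ _ (fun x : R => x `^ 2)%R) => //.
  exact/measurableT_comp.
move: fg; rewrite /finite_norm; apply: le_lt_trans.
rewrite unlock gt0_ler_poweR//.
- by rewrite in_itv/= leey integral_ge0.
- by rewrite in_itv/= leey integral_ge0.
- apply: ge0_le_integral => //=.
  + by apply: mc; exact: measurable_funM.
  + exact: mc.
  + move=> x _; rewrite lee_fin ge0_ler_powR ?nnegrE//.
    by rewrite normrM ler_piMl.
Qed.

Lemma L2pred_expi_mul (h : measurableTypeR R -> R) f : measurable_fun setT h ->
  f \in L2pred -> (fun t => expi (h t) * f t) \in L2pred.
Proof.
move=> mh; have p1 : (1 <= 2%:E :> \bar R)%E by rewrite lee_fin ler1n.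
have [_ LD] := Lfun_submod_closed mu p1.
have mcos : measurable_fun setT (fun t : measurableTypeR R => cos (h t)).
  apply: (measurableT_comp _ mh); apply: continuous_measurable_fun.
  exact: continuous_cos.
have msin : measurable_fun setT (fun t : measurableTypeR R => sin (h t)).
  apply: (measurableT_comp _ mh); apply: continuous_measurable_fun.
  exact: continuous_sin.
have cos1 t : `|cos (h t)| <= 1 by rewrite ler_norml cos_geN1 cos_le1.
have sin1 t : `|sin (h t)| <= 1 by rewrite ler_norml sin_geN1 sin_le1.
move=> /L2predP[f1 f2]; apply/L2predP; split.
  set F := (X in X \in _).
  have -> : F = (-1) *: ((fun t => sin (h t)) \* (@complex.Im R \o f)) +
      ((fun t => cos (h t)) \* (@complex.Re R \o f)).
    apply/funext => t; rewrite /F !fctE/=; case: (f t) => u v /=.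
    by rewrite /GRing.scale/=; ring.
  exact: (LD (-1) _ _ (Lfun2_mul_bounded msin sin1 f2)
                      (Lfun2_mul_bounded mcos cos1 f1)).
set F := (X in X \in _).
have -> : F = 1 *: ((fun t => sin (h t)) \* (@complex.Re R \o f)) +
    ((fun t => cos (h t)) \* (@complex.Im R \o f)).
  apply/funext => t; rewrite /F !fctE/=; case: (f t) => u v /=.
  by rewrite /GRing.scale/=; ring.
exact: (LD 1 _ _ (Lfun2_mul_bounded msin sin1 f1)
                 (Lfun2_mul_bounded mcos cos1 f2)).
Qed.

Lemma L2pred_cst (c : R[i]) : (fun=> c) \in L2pred.
Proof. by apply/L2predP; split; exact: Lfun_cst. Qed.

Fact mulz_subproof (f : L2) : (fun t => expi t * f t) \in L2pred.
Proof. by apply: (@L2pred_expi_mul id) => //; exact: valP. Qed.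
(* multiplication by the coordinate function z = e^{it} *)
Definition mulz (f : L2) : L2 := L2class (MkL2fun (mulz_subproof f)).

Fact zpow_subproof (n : int) : (fun t => expi (n%:~R * t)) \in L2pred.
Proof.
rewrite (_ : (fun t => _) = fun t => expi (n%:~R * t) * 1); last first.
  by apply/funext => t; rewrite mulr1.
apply: (@L2pred_expi_mul (fun t => n%:~R * t)); last exact: L2pred_cst.
by apply: measurable_funM.
Qed.
Definition zpow (n : int) : L2 := L2class (MkL2fun (zpow_subproof n)).

Definition cintegral (F : R -> R[i]) : R[i] :=
  (\int[mu]_t complex.Re (F t)) +i* (\int[mu]_t complex.Im (F t)).

(* linear in the first argument, conjugate-linear in the second *)
Definition ip (f g : L2) : R[i] := cintegral (fun t => f t * (g t)^*).


Definition cintegrable (F : R -> R[i]) : Prop :=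
  ((@complex.Re R \o F) : measurableTypeR R -> R) \in Lfun mu 1 /\
  ((@complex.Im R \o F) : measurableTypeR R -> R) \in Lfun mu 1.

Lemma cintegrable_mul_conj f g : f \in L2pred -> g \in L2pred ->
  cintegrable (fun t => f t * (g t)^*).
Proof.
move=> /L2predP[f1 f2] /L2predP[g1 g2].
have [_ LD] := Lfun_submod_closed mu (lexx 1%E).
split.
  set F := (X in X \in _).
  have -> : F = 1 *: ((@complex.Re R \o f) \* (@complex.Re R \o g)) +
                (@complex.Im R \o f) \* (@complex.Im R \o g).
    apply/funext => t; rewrite /F !fctE/=; case: (f t) (g t) => u v [u' v'] /=.
    by rewrite /GRing.scale/=; ring.
  exact: (LD 1 _ _ (Lfun2_mul_Lfun1 f1 g1) (Lfun2_mul_Lfun1 f2 g2)).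
set F := (X in X \in _).
have -> : F = (-1) *: ((@complex.Re R \o f) \* (@complex.Im R \o g)) +
              (@complex.Im R \o f) \* (@complex.Re R \o g).
  apply/funext => t; rewrite /F !fctE/=; case: (f t) (g t) => u v [u' v'] /=.
  by rewrite /GRing.scale/=; ring.
exact: (LD (-1) _ _ (Lfun2_mul_Lfun1 f1 g2) (Lfun2_mul_Lfun1 f2 g1)).
Qed.

Lemma Rintegral_lin (a b : R) (F G H : measurableTypeR R -> R) :
  F \in Lfun mu 1 -> G \in Lfun mu 1 -> H \in Lfun mu 1 ->
  \int[mu]_t (a * F t + b * G t + H t) =
  a * \int[mu]_t F t + b * \int[mu]_t G t + \int[mu]_t H t.
Proof.
move=> /Lfun1_integrable iF /Lfun1_integrable iG /Lfun1_integrable iH.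
have iaF := integrableZl measurableT a iF.
have ibG := integrableZl measurableT b iG.
rewrite RintegralD//; last exact: (integrableD measurableT iaF ibG).
by rewrite RintegralD// !RintegralZl.
Qed.

Lemma cintegral_lin (a : R[i]) F G : cintegrable F -> cintegrable G ->
  cintegral (fun t => a * F t + G t) = a * cintegral F + cintegral G.
Proof.
case: a => a b [F1 F2] [G1 G2].
have E1 := Rintegral_lin a (- b) F1 F2 G1.
have E2 := Rintegral_lin b a F1 F2 G2.
apply/eqP; rewrite eq_complex/=; apply/andP; split; apply/eqP.
  rewrite -mulNr [RHS](esym E1); apply: eq_Rintegral => t _.
  by rewrite /=; case: (F t) (G t) => u v [u' v'] /=; ring.
rewrite [X in X + _]addrC [RHS](esym E2); apply: eq_Rintegral => t _.
by rewrite /=; case: (F t) (G t) => u v [u' v'] /=; ring.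
Qed.

Lemma Rintegral_ae (F G : measurableTypeR R -> R) :
  F \in Lfun mu 1 -> G \in Lfun mu 1 -> {ae mu, forall t, F t = G t} ->
  \int[mu]_t F t = \int[mu]_t G t.
Proof.
move=> /Lfun1_integrable/measurable_int mF /Lfun1_integrable/measurable_int mG h.
congr fine; apply: ae_eq_integral => //.
by move: h; apply: circle_aeS => t /= -> _.
Qed.

Lemma cintegral_ae F G : cintegrable F -> cintegrable G ->
  {ae mu, forall t, F t = G t} -> cintegral F = cintegral G.
Proof.
move=> [F1 F2] [G1 G2] h; congr (_ +i* _).
  by apply: (Rintegral_ae F1 G1); move: h; apply: circle_aeS => t /= ->.
by apply: (Rintegral_ae F2 G2); move: h; apply: circle_aeS => t /= ->.
Qed.

Lemma L2integrable (f g : L2fun) : cintegrable (fun t => f t * (g t)^*).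
Proof. by apply: cintegrable_mul_conj; exact: valP. Qed.

Lemma ip_class (f g : L2fun) :
  ip (L2class f) (L2class g) = cintegral (fun t => f t * (g t)^*).
Proof.
apply: cintegral_ae; [exact: L2integrable|exact: L2integrable|].
by apply: circle_aeS2 (L2classE f) (L2classE g) => t -> ->.
Qed.

Fact ip_linearl (h : L2) : linear_for *%R (ip^~ h).
Proof.
move=> a f g.
rewrite -[f]L2reprK -[g]L2reprK -[h]L2reprK.
rewrite [a *: _]L2class_scale -L2classD !ip_class.
rewrite -cintegral_lin; [|exact: L2integrable|exact: L2integrable].
by congr cintegral; apply/funext => t; rewrite /= mulrDl mulrA.
Qed.

Fact ip_hermitian (f g : L2) : ip f g = (-1) ^+ false * Num.conj (ip g f).
Proof.
rewrite expr0 mul1r -[Num.conj _]/((ip g f)^*) /ip /cintegral /=; congr (_ +i* _).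
  by apply: eq_Rintegral => t _; case: (f t) (g t) => u v [u' v'] /=; ring.
have [_ i2] := L2integrable (L2repr g) (L2repr f).
transitivity (- 1 * (\int[mu]_t complex.Im (g t * (f t)^*))); last by rewrite mulN1r.
rewrite -RintegralZl//; last exact/Lfun1_integrable.
by apply: eq_Rintegral => t _; case: (f t) (g t) => u v [u' v'] /=; ring.
Qed.

Fact ip_linearr (f : L2) : linear_for (Num.conj \; *%R) (ip f).
Proof.
move=> a g h; rewrite [LHS]ip_hermitian ip_linearl /= !expr0 !mul1r.
by rewrite [ip f g]ip_hermitian [ip f h]ip_hermitian !expr0 !mul1r rmorphD rmorphM.
Qed.

Fact ip_gt0 (f : L2) : f != 0 -> 0 < ip f f.
Proof.
move=> f0; have [i1 _] := L2integrable (L2repr f) (L2repr f).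
pose w t := complex.Re (f t * (f t)^*).
have wE t : w t = complex.Re (f t) ^+ 2 + complex.Im (f t) ^+ 2.
  by rewrite /w; case: (f t) => u v /=; ring.
have w0 t : 0 <= w t by rewrite wE addr_ge0 ?sqr_ge0.
have -> : ip f f = (\int[mu]_t w t)%:C.
  congr (_ +i* _).
  transitivity (\int[mu]_t (cst 0 t : R)).
    by apply: eq_Rintegral => t _; case: (f t) => u v /=; ring.
  by rewrite Rintegral_cst// mul0r.
rewrite ltcR lt_neqAle Rintegral_ge0// andbT eq_sym.
apply: contra f0 => /eqP int0; apply/eqP; apply/L2eqP.
have iw : mu.-integrable setT (EFin \o w) by exact/Lfun1_integrable.
have : (\int[mu]_t `|(w t)%:E| = 0)%E.
  transitivity (\int[mu]_t (w t)%:E)%E.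
    by apply: eq_integral => t _; rewrite gee0_abs// lee_fin.
  by rewrite -[LHS]fineK ?integrable_fin_num//; congr (_%:E).
move=> /(ae_eq_integral_abs mu measurableT (measurable_int _ iw)) w_ae0.
have f_ae0 : {ae mu, forall t, f t = 0}.
  move: w_ae0; apply: circle_aeS => t /= /(_ I) [] /eqP.
  rewrite wE paddr_eq0 ?sqr_ge0// !sqrf_eq0 => /andP[/eqP u0 /eqP v0].
  by apply/eqP; rewrite eq_complex u0 v0 !eqxx.
have zE : {ae mu, forall t, (0 : L2) t = 0}.
  by have := L2classE 0; rewrite L2class0.
by apply: circle_aeS2 f_ae0 zE => t -> ->.
Qed.

HB.instance Definition _ := bilinear_isBilinear.Build R[i] L2 L2 R[i]
  *%R (Num.conj \; *%R) ip (ip_linearl, ip_linearr).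
HB.instance Definition _ := isHermitianSesquilinear.Build R[i] L2 false Num.conj
  ip ip_hermitian.
HB.instance Definition _ := isDotProduct.Build R[i] L2 ip ip_gt0.

Definition hnorm (f : L2) : R := Num.sqrt (complex.Re (ip f f)).

Lemma Re_ip_ge0 (f : L2) : 0 <= complex.Re (ip f f).
Proof. by have := dnorm_ge0 ip f; rewrite lecE => /andP[]. Qed.

Lemma hnorm_ge0 f : 0 <= hnorm f.
Proof. exact: sqrtr_ge0. Qed.

Lemma hnorm0 : hnorm 0 = 0.
Proof. by rewrite /hnorm (linear0l ip) sqrtr0. Qed.

Lemma hnormZ a (f : L2) :
  hnorm (a *: f) = Num.sqrt (complex.Re a ^+ 2 + complex.Im a ^+ 2) * hnorm f.
Proof.
rewrite /hnorm (dnormZ ip) -add_Re2_Im2 -sqrtrM ?addr_ge0 ?sqr_ge0//.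
congr Num.sqrt; rewrite (_ : forall (x : R) z, complex.Re (x%:C * z) = x * complex.Re z)//.
by move=> x [u v] /=; ring.
Qed.

Lemma hnormD_le (f g : L2) : hnorm (f + g) <= 2 * (hnorm f + hnorm g).
Proof.
have f0 := hnorm_ge0 f; have g0 := hnorm_ge0 g.
rewrite -(@ler_pXn2r _ 2)// ?nnegrE ?hnorm_ge0 ?mulr_ge0 ?addr_ge0//.
have hfg : hnorm (f + g) ^+ 2 + hnorm (f - g) ^+ 2 =
    2 * hnorm f ^+ 2 + 2 * hnorm g ^+ 2.
  rewrite !sqr_sqrtr ?Re_ip_ge0// (dnormD ip) (dnormB ip).
  have E (x y z : R[i]) : complex.Re (x + y + (z + z^*)) +
      complex.Re (x + y - (z + z^*)) = 2 * complex.Re x + 2 * complex.Re y.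
    by case: x y z => u v [u' v'] [u'' v''] /=; ring.
  exact: E.
have := sqr_ge0 (hnorm (f - g)); nra.
Qed.

(* [ip f (zpow n)] is the n-th Fourier coefficient of f *)
Definition hardy : set L2 :=
  [set f | forall n : int, n < 0 -> ip f (zpow n) = 0].

Implicit Types theta : R[i] -> R[i].

(* boundary value at e^{it} of a function on the disk; for a bounded analytic
   function it exists for almost every t *)
Definition radial_limit theta (t : R) : R[i] :=
  lim ((theta (r%:C * expi t) : R[i]^o) @[r --> (1 : R)^'-]).

(* Only the values of theta on the open unit disk matter. The algebra R[i]^o is
   R[i] as a normed space over itself, so derivability at z in the direction 1
   is complex differentiability at z. *)
Record inner theta : Prop := {
  inner_holomorphic : forall z, `|z| < 1 ->
    derivable (theta : R[i]^o -> R[i]^o) z 1;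
  inner_bounded : exists M : R, forall z, `|z| < 1 -> `|theta z| <= M%:C;
  inner_unimodular : {ae mu, forall t,
    cvg ((theta (r%:C * expi t) : R[i]^o) @[r --> (1 : R)^'-]) /\
    `|radial_limit theta t| = 1} }.

(* theta H^2 *)
Definition theta_hardy theta : set L2 :=
  [set g | exists2 h : L2, hardy h &
    {ae mu, forall t, g t = radial_limit theta t * h t}].

(* H^2 (-) theta H^2 *)
Definition model_pred theta : {pred L2} :=
  mem [set f | hardy f /\ forall g, theta_hardy theta g -> ip f g = 0].

Lemma model_pred_submod_closed theta : submod_closed (model_pred theta).
Proof.
have ip0 (g : L2) : ip 0 g = 0 by exact: (linear0l ip g).
split; first by rewrite inE; split=> [n _|g _]; exact: ip0.
move=> a f g; rewrite !inE => -[hf kf] [hg kg]; split=> [n n0|h th].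
  by rewrite [LHS](ip_linearl _ a f g) hf// hg// mulr0 addr0.
by rewrite [LHS](ip_linearl _ a f g) kf// kg// mulr0 addr0.
Qed.
HB.instance Definition _ theta := GRing.isSubmodClosed.Build _ _
  (model_pred theta) (model_pred_submod_closed theta).

Record model_space theta := MkModel {
  model_val :> L2;
  _ : model_val \in model_pred theta }.
HB.instance Definition _ theta := [isSub for @model_val theta].
HB.instance Definition _ theta := [Choice of model_space theta by <:].
HB.instance Definition _ theta :=
  [SubChoice_isSubLmodule of model_space theta by <:].

Section operators.
Variable theta : R[i] -> R[i].
Local Notation K := (model_space theta).

(* The orthogonal projection of f onto K is the unique g in K with f - g
   orthogonal to K (0 is the default of the choice operator). *)
Definition model_proj (f : L2) : K :=
  xget 0 [set g : K | forall k : K, ip (f - model_val g) k = 0].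

Definition compressed_shift (f : K) : K := model_proj (mulz f).

(* The adjoint of a bounded operator is the unique B with <A f, g> = <f, B g>
   (0 is the default of the choice operator). *)
Definition adjoint (A : K -> K) : K -> K :=
  xget 0 [set B : K -> K | forall f g : K, ip (A f) g = ip f (B g)].

Definition bounded_linear_pred : {pred (K -> K)} :=
  mem [set X : K -> K |
    linear X /\ exists M : R, forall f : K, hnorm (X f) <= M * hnorm f].


Lemma bounded_linear_submod_closed : submod_closed bounded_linear_pred.
Proof.
have op0E (f : K) : (0 : K -> K) f = 0 by [].
have opE a (X Y : K -> K) f : (a *: X + Y) f = a *: X f + Y f by [].
split.
  rewrite inE; split=> [a f g|]; first by rewrite !op0E scaler0 addr0.
  by exists 0 => f; rewrite mul0r op0E hnorm0.
move=> a X Y; rewrite !inE => -[linX [M XM]] [linY [N YN]]; split=> [b f g|].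
  rewrite !opE linX linY !scalerDr !scalerA (mulrC b a).
  by rewrite !addrA; congr (_ + _); rewrite addrAC.
set c := Num.sqrt (complex.Re a ^+ 2 + complex.Im a ^+ 2).
exists (2 * (c * M + N)) => f.
apply: (le_trans (hnormD_le (a *: model_val (X f)) (Y f))).
rewrite hnormZ -/c -mulrA ler_wpM2l// mulrDl lerD// -mulrA.
by rewrite ler_wpM2l// sqrtr_ge0.
Qed.
HB.instance Definition _ := GRing.isSubmodClosed.Build _ _
  bounded_linear_pred bounded_linear_submod_closed.

Record bounded_op := MkBoundedOp {
  bounded_op_fun :> K -> K;
  _ : bounded_op_fun \in bounded_linear_pred }.
HB.instance Definition _ := [isSub for bounded_op_fun].
HB.instance Definition _ := [Choice of bounded_op by <:].
HB.instance Definition _ := [SubChoice_isSubLmodule of bounded_op by <:].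

End operators.
End circle.

Arguments model_proj {R} theta f.
Arguments compressed_shift {R} theta f.
Arguments adjoint {R theta} A.

(* Main.v *)
Require Import Defs.
From HB Require Import structures.
From mathcomp Require Import all_boot all_order all_algebra.
From mathcomp Require Import all_classical all_reals all_analysis.
From mathcomp Require Import complex.
From mathcomp Require Import measurable_realfun sesquilinear.
From mathcomp Require Import ring lra zify.

Set Implicit Arguments.
Unset Strict Implicit.
Unset Printing Implicit Defensive.

Import Order.TTheory GRing.Theory Num.Theory.
Import numFieldNormedType.Exports.
Import Normc.
Local Open Scope classical_set_scope.
Local Open Scope ring_scope.
Local Open Scope complex_scope.

(** Let K be the model space of theta, S the compressed shift and B its adjoint.
   Since z f is orthogonal to z theta H^2 for every f in K, projecting z f onto
   K only removes its component along theta: S f = z f - <z f, theta> theta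
   (shift_subproof, compressed_shiftE). The adjoint is the backward shift
   B f = (f - f(0)) / z, which leaves K invariant (bshift_subproof,
   adjoint_compressed_shiftE). Both S and B are contractions. Moreover B^n tends
   strongly to 0: a power of B kills any given analytic polynomial, and these are
   dense in H^2 (iter_bshift_small).

   Let A be either S or B. If X = A X B, then X = A^n X B^n for every n, so the
   norm of X f is at most a constant times the norm of B^n f, and X = 0. Applied
   to differences, this is the injectivity of X |-> X - A X B
   (displacement_inj), and the two choices of A give D_T and D_H.

   This argument rests on two facts of analysis.

   Density: trigonometric polynomials are dense in L^2 of the circle
   (trig_closure_L2). The bounded functions b such that multiplication by b
   preserves the closure of the trigonometric polynomials form an algebra, closed
   under bounded pointwise limits, that contains the characters. The limit of
   (1 - u^n)^(n 2^n) is the indicator of the set where u < 1/2; taking for u a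
   trigonometric polynomial of degree one gives the indicators of initial arcs,
   hence those of all Borel sets, hence all bounded measurable functions.
   Truncation then reaches L^2. Removing the negative frequencies of an
   approximant gives the density of analytic polynomials in H^2 (hardy_dense).

   Boundary values: the radial limits of theta are the values of a function of
   modulus one in H^2 (boundary_function), and multiplication by it preserves H^2
   (hardy_bmul). For r < 1 the negative Fourier coefficients of
   t |-> theta(r e^{it}) are integrals of holomorphic functions around circles, so
   they vanish, and dominated convergence lets r tend to 1. As theta is
   only assumed to be complex differentiable at each point of the disk, Cauchy's
   theorem on circles (cauchy_circle) is proved by the bisection argument of
   Goursat, run on rectangles in polar coordinates. *)

(** * Bounded multipliers and the inner product of L^2 *)

Section multipliers.
Variable R : realType.
Local Notation mu := (@circle_measure R).
Local Notation Re := (@complex.Re R).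
Local Notation Im := (@complex.Im R).
Implicit Types (b c F : R -> R[i]) (f g : L2 R).

(** Functions bounded and measurable everywhere rather than almost everywhere:
   their products and pointwise limits need no choice of representatives. *)
Record bounded_mfun b : Prop := BoundedMfun {
  bounded_mfun_Re : measurable_fun setT (Re \o b : measurableTypeR R -> R);
  bounded_mfun_Im : measurable_fun setT (Im \o b : measurableTypeR R -> R);
  bounded_mfun_bnd : exists M : R,
    forall t, `|Re (b t)| <= M /\ `|Im (b t)| <= M }.

Lemma bounded_mfun_cst (a : R[i]) : bounded_mfun (fun=> a).
Proof.
split; [exact: measurable_cst|exact: measurable_cst|].
by exists (Num.max `|Re a| `|Im a|) => t; rewrite !le_max !lexx orbT.
Qed.

Lemma bounded_mfunD b c : bounded_mfun b -> bounded_mfun c ->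
  bounded_mfun (fun t => b t + c t).
Proof.
move=> [b1 b2 [M bM]] [c1 c2 [N cN]]; split.
- rewrite (_ : _ \o _ = (Re \o b) \+ (Re \o c)); first exact: measurable_funD.
  by apply/funext => t /=; rewrite raddfD.
- rewrite (_ : _ \o _ = (Im \o b) \+ (Im \o c)); first exact: measurable_funD.
  by apply/funext => t /=; rewrite raddfD.
exists (M + N) => t; have [? ?] := bM t; have [? ?] := cN t.
by rewrite !raddfD /=; split; apply: (le_trans (ler_normD _ _)); apply: lerD.
Qed.

Lemma complex_ReM (x y : R[i]) : Re (x * y) = Re x * Re y - Im x * Im y.
Proof. by case: x y => a b [c d]. Qed.

Lemma complex_ImM (x y : R[i]) : Im (x * y) = Re x * Im y + Im x * Re y.
Proof. by case: x y => a b [c d]. Qed.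

Lemma bounded_mfunM b c : bounded_mfun b -> bounded_mfun c ->
  bounded_mfun (fun t => b t * c t).
Proof.
move=> [b1 b2 [M bM]] [c1 c2 [N cN]]; split.
- rewrite (_ : _ \o _ = (Re \o b) \* (Re \o c) \- (Im \o b) \* (Im \o c)).
    by apply: measurable_funB; exact: measurable_funM.
  by apply/funext => t /=; rewrite complex_ReM.
- rewrite (_ : _ \o _ = (Re \o b) \* (Im \o c) \+ (Im \o b) \* (Re \o c)).
    by apply: measurable_funD; exact: measurable_funM.
  by apply/funext => t /=; rewrite complex_ImM.
exists (M * N + M * N) => t; have [? ?] := bM t; have [? ?] := cN t.
rewrite complex_ReM complex_ImM; split; first apply: (le_trans (ler_normB _ _)).
  by rewrite !normrM lerD// ler_pM.
by apply: (le_trans (ler_normD _ _)); rewrite !normrM lerD// ler_pM.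
Qed.

Lemma bounded_mfun_conj b : bounded_mfun b -> bounded_mfun (fun t => conjc (b t)).
Proof.
move=> [b1 b2 [M bM]]; split.
- rewrite (_ : _ \o _ = Re \o b)//.
  by apply/funext => t /=; case: (b t).
- rewrite (_ : _ \o _ = \- (Im \o b)); first exact: measurable_funN.
  by apply/funext => t /=; case: (b t).
by exists M => t; have := bM t; case: (b t) => x y /=; rewrite normrN.
Qed.

Lemma bounded_mfun_real (u : measurableTypeR R -> R) (M : R) :
  measurable_fun setT u -> (forall t, `|u t| <= M) ->
  bounded_mfun (fun t => (u t)%:C).
Proof.
move=> mu uM; split; [exact: mu|exact: measurable_cst|].
by exists M => t; split; [exact: uM|rewrite normr0 (le_trans _ (uM t))].
Qed.

Lemma bounded_mfun_expi (h : measurableTypeR R -> R) : measurable_fun setT h ->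
  bounded_mfun (fun t => expi (h t)).
Proof.
move=> mh; split.
- apply: (measurableT_comp _ mh); apply: continuous_measurable_fun.
  exact: continuous_cos.
- apply: (measurableT_comp _ mh); apply: continuous_measurable_fun.
  exact: continuous_sin.
exists 1 => t /=.
by rewrite !ler_norml cos_geN1 cos_le1 sin_geN1 sin_le1.
Qed.

Lemma L2pred_bounded_mul b F : bounded_mfun b -> F \in @L2pred R ->
  (fun t => b t * F t) \in @L2pred R.
Proof.
move=> [b1 b2 [M bM]]; have p1 : (1 <= 2%:E :> \bar R)%E by rewrite lee_fin ler1n.
have [_ LD] := Lfun_submod_closed mu p1.
have M0 : 0 <= M by have [+ _] := bM 0; apply: le_trans.
have N0 : 0 < M + 1 by lra.
have mulL (u v : measurableTypeR R -> R) : measurable_fun setT u ->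
    (forall t, `|u t| <= M) -> v \in Lfun mu 2%:E ->
    ((u \* v : measurableTypeR R -> R) \in Lfun mu 2%:E).
  move=> mu' uM v2; pose w t := (M + 1)^-1 * u t.
  have w1 : (w \* v : measurableTypeR R -> R) \in Lfun mu 2%:E.
    apply: Lfun2_mul_bounded => //; first exact: measurable_funM.
    move=> t; rewrite /w normrM ger0_norm ?invr_ge0 ?(ltW N0)//.
    rewrite ler_pdivrMl// mulr1 (le_trans (uM t))//; lra.
  have -> : u \* v = (M + 1) *: (w \* v : measurableTypeR R -> R) + 0.
    apply/funext => t; rewrite !fctE /w addr0 /GRing.scale/= !mulrA divff ?mul1r//.
    by rewrite gt_eqF.
  by apply: LD => //; have [] := Lfun_submod_closed mu p1.
move=> /L2predP[f1 f2]; apply/L2predP; split.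
  set G := (X in X \in _).
  have -> : G = (-1) *: ((Im \o b) \* (Im \o F)) + ((Re \o b) \* (Re \o F)).
    by apply/funext => t; rewrite /G !fctE/= complex_ReM /GRing.scale/=; ring.
  by apply: LD; apply: mulL => // t; have [] := bM t.
set G := (X in X \in _).
have -> : G = 1 *: ((Im \o b) \* (Re \o F)) + ((Re \o b) \* (Im \o F)).
  by apply/funext => t; rewrite /G !fctE/= complex_ImM /GRing.scale/=; ring.
by apply: LD; apply: mulL => // t; have [] := bM t.
Qed.

Lemma bounded_mfun_L2 b : bounded_mfun b -> b \in @L2pred R.
Proof.
move=> bb; rewrite (_ : b = fun t => b t * 1); last first.
  by apply/funext => t; rewrite mulr1.
by apply: L2pred_bounded_mul => //; exact: L2pred_cst.
Qed.

(** The zero class is a default when F is not square integrable. *)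
Definition L2of F : L2 R := L2class (insubd 0 F).

Lemma L2ofE F : F \in @L2pred R -> {ae mu, forall t, L2of F t = F t}.
Proof.
move=> F2; have := L2classE (insubd 0 F); apply: circle_aeS => t ->.
by rewrite -[L2fun_val _]/(val _) insubdK.
Qed.

Definition bmul b f : L2 R := L2of (fun t => b t * f t).

Lemma bmulE b f : bounded_mfun b -> {ae mu, forall t, bmul b f t = b t * f t}.
Proof. by move=> bb; apply/L2ofE/L2pred_bounded_mul => //; exact: valP. Qed.

Lemma circle_aeAnd (P Q : R -> Prop) : {ae mu, forall t, P t} ->
  {ae mu, forall t, Q t} -> {ae mu, forall t, P t /\ Q t}.
Proof. exact: circle_aeS2. Qed.

Lemma bmul_linear b : bounded_mfun b -> linear (bmul b).
Proof.
move=> bb a f g; apply/L2eqP.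
have h1 := circle_aeAnd (bmulE (a *: f + g) bb) (L2addE (a *: f) g).
have h2 := circle_aeAnd (L2scaleE a f) (L2addE (a *: bmul b f) (bmul b g)).
have h3 := circle_aeAnd (bmulE f bb) (bmulE g bb).
have h4 := circle_aeAnd (circle_aeAnd h1 h2) (L2scaleE a (bmul b f)).
apply: circle_aeS2 h4 h3 => t [[[-> ->] [-> ->]] ->] [-> ->].
by rewrite mulrDr mulrCA.
Qed.

Lemma bmulD b f g : bounded_mfun b -> bmul b (f + g) = bmul b f + bmul b g.
Proof. by move=> bb; have := bmul_linear bb 1 f g; rewrite !scale1r. Qed.

Lemma bmul0 b : bounded_mfun b -> bmul b 0 = 0.
Proof.
by move=> bb; apply: (addIr (bmul b 0)); rewrite -bmulD// !add0r.
Qed.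

Lemma bmulZ b a f : bounded_mfun b -> bmul b (a *: f) = a *: bmul b f.
Proof. by move=> bb; have := bmul_linear bb a f 0; rewrite bmul0// !addr0. Qed.

Lemma bmulB b f g : bounded_mfun b -> bmul b (f - g) = bmul b f - bmul b g.
Proof. by move=> bb; rewrite -scaleN1r bmulD// bmulZ// scaleN1r. Qed.

Lemma bmulA b c f : bounded_mfun b -> bounded_mfun c ->
  bmul b (bmul c f) = bmul (fun t => b t * c t) f.
Proof.
move=> bb bc; apply/L2eqP.
have h := circle_aeAnd (bmulE (bmul c f) bb) (bmulE f bc).
apply: circle_aeS2 h (bmulE f (bounded_mfunM bb bc)) => t [-> ->] ->.
by rewrite mulrA.
Qed.

Lemma bmulC b c f : bounded_mfun b -> bounded_mfun c ->
  bmul b (bmul c f) = bmul c (bmul b f).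
Proof.
move=> bb bc; rewrite !bmulA//; congr bmul.
by apply/funext => t; rewrite mulrC.
Qed.

Lemma bmulDl b c f : bounded_mfun b -> bounded_mfun c ->
  bmul (fun t => b t + c t) f = bmul b f + bmul c f.
Proof.
move=> bb bc; apply/L2eqP.
have h := circle_aeAnd (bmulE f bb) (bmulE f bc).
have h' := circle_aeAnd (bmulE f (bounded_mfunD bb bc)) (L2addE (bmul b f) (bmul c f)).
by apply: circle_aeS2 h h' => t [e1 e2] [-> ->]; rewrite e1 e2 mulrDl.
Qed.

Lemma bmul_cst (a : R[i]) f : bmul (fun=> a) f = a *: f.
Proof.
apply/L2eqP.
by apply: circle_aeS2 (bmulE f (bounded_mfun_cst a)) (L2scaleE a f) => t -> ->.
Qed.

Lemma bmul_ae b c f : bounded_mfun b -> bounded_mfun c ->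
  {ae mu, forall t, b t = c t} -> bmul b f = bmul c f.
Proof.
move=> bb bc bec; apply/L2eqP.
have h := circle_aeAnd (bmulE f bb) (bmulE f bc).
by apply: circle_aeS2 h bec => t [-> ->] ->.
Qed.

Lemma ip_ae f g f' g' :
  {ae mu, forall t, f t * conjc (g t) = f' t * conjc (g' t)} -> ip f g = ip f' g'.
Proof. by apply: cintegral_ae; exact: L2integrable. Qed.

Lemma ip_bmul b f g : bounded_mfun b ->
  ip (bmul b f) g = ip f (bmul (fun t => conjc (b t)) g).
Proof.
move=> bb; apply: ip_ae.
apply: circle_aeS2 (bmulE f bb) (bmulE g (bounded_mfun_conj bb)) => t -> ->.
by rewrite rmorphM /= conjcK mulrCA mulrA.
Qed.

Lemma ip_bmul_unimodular b f g : bounded_mfun b ->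
  {ae mu, forall t, b t * conjc (b t) = 1} -> ip (bmul b f) (bmul b g) = ip f g.
Proof.
move=> bb b1; apply: ip_ae.
have h := circle_aeAnd (bmulE f bb) (bmulE g bb).
apply: circle_aeS2 h b1 => t [-> ->] e.
by rewrite rmorphM mulrACA e mul1r.
Qed.

Lemma hnorm_sqr f : hnorm f ^+ 2 = Re (ip f f).
Proof. by rewrite sqr_sqrtr// Re_ip_ge0. Qed.

Lemma ip_hnorm f : ip f f = (hnorm f ^+ 2)%:C.
Proof.
have Im0 : Im (ip f f) = 0.
  by have := dnorm_ge0 (@ip R) f; rewrite lecE => /andP[/eqP].
by rewrite hnorm_sqr; move: Im0; case: (ip f f) => x y /= ->.
Qed.

Lemma hnorm_bmul b f : bounded_mfun b ->
  {ae mu, forall t, b t * conjc (b t) = 1} -> hnorm (bmul b f) = hnorm f.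
Proof. by move=> bb b1; rewrite /hnorm ip_bmul_unimodular. Qed.

Lemma hnorm_eq0 f : hnorm f = 0 -> f = 0.
Proof.
move=> f0; apply/eqP; rewrite -(dnorm_eq0 (@ip R)).
by rewrite [X in X == _]ip_hnorm f0 expr0n.
Qed.

Lemma ipDl f g h : ip (f + g) h = ip f h + ip g h.
Proof. by have := ip_linearl h 1 f g; rewrite scale1r mul1r. Qed.
Lemma ip0l h : ip 0 h = 0 :> R[i].
Proof. exact: (linear0l (@ip R) h). Qed.
Lemma ipZl a f h : ip (a *: f) h = a * ip f h.
Proof. by have := ip_linearl h a f 0; rewrite addr0 ip0l addr0. Qed.
Lemma ipNl f h : ip (- f) h = - ip f h.
Proof. by rewrite -scaleN1r ipZl mulN1r. Qed.
Lemma ipBl f g h : ip (f - g) h = ip f h - ip g h.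
Proof. by rewrite ipDl ipNl. Qed.
Lemma ipC f g : ip f g = conjc (ip g f).
Proof. by have := ip_hermitian f g; rewrite expr0 mul1r. Qed.
Lemma ipDr f g h : ip h (f + g) = ip h f + ip h g.
Proof. by rewrite (ipC h f) (ipC h g) ipC ipDl rmorphD. Qed.
Lemma ip0r h : ip h 0 = 0 :> R[i].
Proof. by rewrite ipC ip0l conjc0. Qed.
Lemma ipZr a f h : ip h (a *: f) = conjc a * ip h f.
Proof. by rewrite (ipC h f) ipC ipZl rmorphM. Qed.
Lemma ipNr f h : ip h (- f) = - ip h f.
Proof. by rewrite (ipC h f) ipC ipNl rmorphN. Qed.
Lemma ipBr f g h : ip h (f - g) = ip h f - ip h g.
Proof. by rewrite ipDr ipNr. Qed.

Lemma hnorm_pythagoras f g : ip f g = 0 ->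
  hnorm (f + g) ^+ 2 = hnorm f ^+ 2 + hnorm g ^+ 2.
Proof.
move=> fg; rewrite !hnorm_sqr ipDl !ipDr fg (ipC g f) fg conjc0 addr0 add0r.
by rewrite raddfD.
Qed.

Lemma hnorm_opp f : hnorm (- f) = hnorm f.
Proof. by rewrite /hnorm ipNl ipNr opprK. Qed.

(** The component of f along g has the same inner product with g as f, and by
   Pythagoras its norm is at most that of f. *)
Lemma Cauchy_Schwarz f g : `|ip f g| <= (hnorm f * hnorm g)%:C.
Proof.
have [->|g0] := eqVneq g 0.
  by rewrite ip0r hnorm0 mulr0 normr0.
have gn0 : hnorm g != 0 by apply: contra_neq g0; exact: hnorm_eq0.
have gg : ip g g != 0.
  by rewrite ip_hnorm eq_complex /= eqxx andbT expf_neq0.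
pose a := ip f g / ip g g.
have og : ip (f - a *: g) g = 0 by rewrite ipBl ipZl divfK// subrr.
have := hnorm_pythagoras (f := f - a *: g) (g := a *: g).
rewrite subrK ipZr og mulr0 => /(_ erefl) fE.
have : hnorm (a *: g) ^+ 2 <= hnorm f ^+ 2 by rewrite fE lerDr sqr_ge0.
rewrite ler_pXn2r// ?nnegrE ?hnorm_ge0// => af.
have aE : `|ip f g| = (hnorm (a *: g) * hnorm g)%:C.
  have -> : ip f g = a * ip g g by rewrite divfK.
  have n1 : `|ip g g| = (hnorm g ^+ 2)%:C.
    by rewrite ip_hnorm ger0_norm// ler0c sqr_ge0.
  rewrite normrM n1 normc_def hnormZ -rmorphM /=; congr (_%:C).
  by rewrite expr2; ring.
by rewrite aE lecR ler_wpM2r// hnorm_ge0.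
Qed.

Lemma mulz_bmul f : mulz f = bmul (@expi R) f.
Proof.
have me : bounded_mfun (@expi R).
  by apply: (@bounded_mfun_expi id); exact: measurable_id.
apply/L2eqP; apply: circle_aeS2 (L2classE (MkL2fun (mulz_subproof f))) (bmulE f me).
by move=> t e1 e2; rewrite e2; exact: e1.
Qed.

Lemma expiD (s t : R) : expi (s + t) = expi s * expi t.
Proof.
rewrite /expi cosD sinD; apply/eqP; rewrite eq_complex /= eqxx /=.
by apply/eqP; ring.
Qed.

Lemma expi_conj (t : R) : conjc (expi t) = expi (- t).
Proof. by rewrite /expi /= cosN sinN. Qed.

Lemma expi0 : expi 0 = 1 :> R[i].
Proof. by rewrite /expi cos0 sin0. Qed.

Lemma expiV (t : R) : expi t * conjc (expi t) = 1.
Proof. by rewrite expi_conj -expiD subrr expi0. Qed.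

Lemma expi_mfun (a : R) : bounded_mfun (fun t => expi (a * t)).
Proof. by apply: bounded_mfun_expi; exact: measurable_funM. Qed.

Lemma zpowE (n : int) : {ae mu, forall t, zpow R n t = expi (n%:~R * t)}.
Proof. exact: L2classE. Qed.

Lemma bmul_zpow (n m : int) :
  bmul (fun t => expi (n%:~R * t)) (zpow R m) = zpow R (n + m).
Proof.
apply/L2eqP.
have h := circle_aeAnd (zpowE (n + m)) (zpowE m).
apply: circle_aeS2 h (bmulE (zpow R m) (expi_mfun n%:~R)) => t [-> e] ->.
by rewrite e -expiD -mulrDl intrD.
Qed.

Lemma hnormD2_le f g h : hnorm (f - h) <= 2 * (hnorm (f - g) + hnorm (g - h)).
Proof. by have := hnormD_le (f - g) (g - h); rewrite addrA subrK. Qed.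

End multipliers.

(** * Dominated convergence and multipliers of trigonometric approximants *)

Section trig_multipliers.
Variable R : realType.
Local Notation mu := (@circle_measure R).
Local Notation Re := (@complex.Re R).
Local Notation Im := (@complex.Im R).
Implicit Types (b c F : R -> R[i]) (f g : L2 R).

(** The squared modulus as a real number, polynomial in the real and imaginary
   parts, so that integrability and limits pass through it directly. *)
Definition sqmod (z : R[i]) : R := Re z ^+ 2 + Im z ^+ 2.

Lemma sqmod_ge0 z : 0 <= sqmod z.
Proof. by rewrite addr_ge0 ?sqr_ge0. Qed.

Lemma sqmodE z : sqmod z = Re (z * conjc z).
Proof. by rewrite /sqmod; case: z => x y /=; ring. Qed.

Lemma sqmodM z w : sqmod (z * w) = sqmod z * sqmod w.
Proof. by rewrite /sqmod; case: z w => x y [x' y'] /=; ring. Qed.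

Lemma sqmod_integrable f : mu.-integrable setT (EFin \o (fun t => sqmod (f t))).
Proof.
have [i1 _] := L2integrable (L2repr f) (L2repr f).
rewrite (_ : (fun t => sqmod (f t)) = Re \o (fun t => f t * conjc (f t))).
  exact/Lfun1_integrable.
by apply/funext => t /=; rewrite sqmodE.
Qed.

Lemma hnorm_sqmod f : (hnorm f ^+ 2)%:E = (\int[mu]_t (sqmod (f t))%:E)%E.
Proof.
rewrite hnorm_sqr -[RHS]fineK; last first.
  exact: integrable_fin_num (sqmod_integrable f).
by congr (_%:E); apply: eq_Rintegral => t _; rewrite sqmodE.
Qed.

(** The L^2 limits of multipliers, of truncations and of the dilations of theta all
   come from this form of dominated convergence. *)
Lemma hnorm_dominated_cvg (h : nat -> L2 R) (G : R -> R) :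
  mu.-integrable setT (EFin \o G) ->
  (forall n, {ae mu, forall t, sqmod (h n t) <= G t}) ->
  {ae mu, forall t, sqmod (h n t) @[n --> \oo] --> (0 : R)} ->
  hnorm (h n) @[n --> \oo] --> (0 : R).
Proof.
move=> iG hG h0.
have [] := @dominated_convergence _ (measurableTypeR R) R mu setT measurableT
  (fun n t => (sqmod (h n t))%:E) (cst 0%:E) (fun t => (G t)%:E).
- by move=> n; exact: measurable_int (sqmod_integrable (h n)).
- exact: measurable_cst.
- move: h0; apply: circle_aeS => t ht _.
  by apply: cvg_EFin => //; near=> x.
- exact: iG.
- have /ae_foralln := hG; apply: circle_aeS => t ht n _.
  by rewrite gee0_abs lee_fin ?sqmod_ge0// ht.
move=> _ _; rewrite integral0 => cv.
rewrite -(@sqrtr0 R).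
rewrite (_ : (fun n => hnorm (h n)) = (fun n => Num.sqrt (hnorm (h n) ^+ 2))).
  apply: continuous_cvg; first exact: sqrt_continuous.
  have cv' : (fun n => (hnorm (h n) ^+ 2)%:E) @ \oo --> 0%:E.
    rewrite (_ : (fun n => _) = fun n => (\int[mu]_t (sqmod (h n t))%:E)%E)//.
    by apply/funext => n; exact: hnorm_sqmod.
  exact: fine_cvg cv'.
by apply/funext => n; rewrite sqrtr_sqr ger0_norm// hnorm_ge0.
Unshelve. all: by end_near. Qed.

(** A sequence of polynomials in u that tends on [0, 1] to the indicator of
   u < 1/2. With N = n 2^n, the product N u^n = n (2u)^n tends to 0 when u < 1/2,
   so that (1 - u^n)^N tends to 1; it is at least n when u >= 1/2, the factor n
   forcing the limit 0 at u = 1/2 as well. *)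
Lemma pow_indicator_cvg (u : R) : 0 <= u <= 1 ->
  (1 - u ^+ n) ^+ (n * 2 ^ n) @[n --> \oo] --> ((u < 2^-1)%R%:R : R).
Proof.
move=> /andP[u0 u1].
have un0 n : 0 <= u ^+ n by rewrite exprn_ge0.
have un1 n : u ^+ n <= 1 by rewrite exprn_ile1.
have bern (y : R) N : 0 <= y -> 1 + N%:R * y <= (1 + y) ^+ N.
  move=> y0; elim: N => [|N IH]; first by rewrite mul0r addr0 expr0.
  rewrite exprS -natr1; have N0 : 0 <= N%:R * y by rewrite mulr_ge0.
  have := ler_wpM2l (addr_ge0 ler01 y0) IH; nra.
have bern' (y : R) N : 0 <= y <= 1 -> 1 - N%:R * y <= (1 - y) ^+ N.
  move=> /andP[y0 y1]; elim: N => [|N IH]; first by rewrite mul0r subr0 expr0.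
  rewrite exprS -natr1; have N0 : 0 <= N%:R * y by rewrite mulr_ge0.
  have y10 : 0 <= 1 - y by lra.
  have := ler_wpM2l y10 IH; nra.
have expE n : (n * 2 ^ n)%:R * u ^+ n = n%:R * (2 * u) ^+ n.
  by rewrite natrM natrX exprMn mulrA.
case: ltP => [u2|u2].
(* n (2u)^n -> 0: as 2u (1+x)^2 <= 1, the inequality of Bernoulli for (1+x)^n
   gives (2u)^n <= (n x)^-2. *)
- pose x := (1 - 2 * u) / 3.
  have x0 : 0 < x by rewrite /x; lra.
  have ux : 2 * u * (1 + x) ^+ 2 <= 1.
    have -> : 2 * u = 1 - 3 * x by rewrite /x; field.
    rewrite expr2; have := mulr_gt0 x0 x0; nra.
  have key n : n%:R * (2 * u) ^+ n <= x ^- 2 * n%:R^-1.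
    case: n => [|n]; first by rewrite mul0r invr0 mulr0.
    have h1 : (2 * u) ^+ n.+1 * ((1 + x) ^+ n.+1) ^+ 2 <= 1.
      rewrite -exprM mulnC exprM -exprMn exprn_ile1// mulr_ge0 ?sqr_ge0//.
      by rewrite mulr_ge0.
    have nx0 : 0 < n.+1%:R * x by rewrite mulr_gt0.
    have h2 : (n.+1%:R * x) ^+ 2 <= ((1 + x) ^+ n.+1) ^+ 2.
      rewrite ler_pXn2r ?nnegrE ?(ltW nx0)//; last by rewrite exprn_ge0//; lra.
      by apply: le_trans (bern x n.+1 (ltW x0)); lra.
    have u20 : 0 <= (2 * u) ^+ n.+1 by rewrite exprn_ge0// mulr_ge0.
    have h3 : (2 * u) ^+ n.+1 * (n.+1%:R * x) ^+ 2 <= 1.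
      by apply: le_trans h1; rewrite ler_wpM2l.
    rewrite -invfM -[leRHS]mul1r ler_pdivlMr; first by move: h3; rewrite exprMn; nra.
    by rewrite mulr_gt0// exprn_gt0.
  apply: (@squeeze_cvgr _ _ _ _ (fun n => 1 - x ^- 2 * n%:R^-1) (fun=> 1)).
  + apply: nearW => n; rewrite exprn_ile1 ?andbT ?subr_ge0 ?gerBl//.
    apply: le_trans (bern' _ _ _); last by rewrite un0 un1.
    by rewrite lerB// expE.
  + rewrite -[X in _ --> X]subr0; apply: cvgB; first exact: cvg_cst.
    rewrite -(mulr0 (x ^- 2)); apply: cvgMr.
    by rewrite -cvg_shiftS; exact: cvg_harmonic.
  + exact: cvg_cst.
(* With y = u^n, (1-y)^N (1 + N y) <= (1 - y^2)^N <= 1 and N y >= n. *)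
- apply: (@squeeze_cvgr _ _ _ _ (fun=> 0) harmonic).
  + apply: nearW => n; rewrite exprn_ge0 ?subr_ge0//=.
    have nN : n%:R <= (n * 2 ^ n)%:R * u ^+ n.
      by rewrite expE ler_peMr// exprn_ege1//; lra.
    have := bern _ (n * 2 ^ n)%N (un0 n).
    set N := (n * 2 ^ n)%N in nN *; set y := u ^+ n in nN *.
    move=> yN.
    have y1 : 0 <= (1 - y) ^+ N by rewrite exprn_ge0// subr_ge0 un1.
    have yy : (1 - y) ^+ N * (1 + y) ^+ N <= 1.
      rewrite -exprMn exprn_ile1//.
        by rewrite mulr_ge0 ?subr_ge0 ?un1// addr_ge0 ?un0.
      by have := sqr_ge0 y; rewrite expr2; nra.
    rewrite -[leRHS]mul1r ler_pdivlMr//.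
    apply: le_trans yy; rewrite ler_wpM2l// (le_trans _ yN)//.
    by rewrite -natr1 addrC lerD2l.
  + exact: cvg_cst.
  + exact: cvg_harmonic.
Qed.

Lemma L2subE f g : {ae mu, forall t, (f - g : L2 R) t = f t - g t}.
Proof.
have := circle_aeAnd (L2addE f (-1 *: g)) (L2scaleE (-1) g).
rewrite scaleN1r; apply: circle_aeS => t [-> ->].
by rewrite mulN1r.
Qed.

Inductive trigpoly : L2 R -> Prop :=
| trigpoly0 : trigpoly 0
| trigpoly_cons (a : R[i]) (n : int) p :
    trigpoly p -> trigpoly (a *: zpow R n + p).

Lemma trigpoly_lin (a : R[i]) p q : trigpoly p -> trigpoly q ->
  trigpoly (a *: p + q).
Proof.
move=> pT; elim: pT q => {p} [|b n p _ IH] q qT; first by rewrite scaler0 add0r.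
by rewrite scalerDr scalerA -addrA; apply: trigpoly_cons; exact: IH.
Qed.

Lemma trigpoly_bmul (m : int) p : trigpoly p ->
  trigpoly (bmul (fun t => expi (m%:~R * t)) p).
Proof.
have mm := @expi_mfun R m%:~R.
elim => [|b n q _ IH]; first by rewrite bmul0//; exact: trigpoly0.
by rewrite bmulD// bmulZ// bmul_zpow; exact: trigpoly_cons.
Qed.

Definition trig_closure f := forall e : R, 0 < e ->
  exists2 p, trigpoly p & hnorm (f - p) < e.

Lemma trig_closure_poly p : trigpoly p -> trig_closure p.
Proof. by move=> pT e e0; exists p; rewrite // subrr hnorm0. Qed.

(** The quarters of e absorb the factor 2 of the weak triangle inequality
   hnormD_le. *)
Lemma trig_closure_lin (a : R[i]) f g : trig_closure f -> trig_closure g ->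
  trig_closure (a *: f + g).
Proof.
move=> fT gT e e0; set c := Num.sqrt (Re a ^+ 2 + Im a ^+ 2).
have c0 : 0 <= c by exact: sqrtr_ge0.
have d0 : 0 < e / 4 / (c + 1).
  by rewrite divr_gt0// ?divr_gt0//; lra.
have e40 : 0 < e / 4 by rewrite divr_gt0.
have [p pT fp] := fT _ d0; have [q qT gq] := gT _ e40.
exists (a *: p + q); first exact: trigpoly_lin.
have -> : a *: f + g - (a *: p + q) = a *: (f - p) + (g - q).
  by rewrite scalerBr opprD addrACA.
apply: le_lt_trans (hnormD_le _ _) _; rewrite hnormZ -/c.
have : c * hnorm (f - p) <= e / 4.
  apply: (@le_trans _ _ ((c + 1) * (e / 4 / (c + 1)))); last first.
    by rewrite mulrC divfK// gt_eqF//; lra.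
  by apply: ler_pM; rewrite ?hnorm_ge0 ?(ltW fp)//; lra.
by move: gq; lra.
Qed.

Lemma trig_closure_lim (g : nat -> L2 R) f : (forall n, trig_closure (g n)) ->
  hnorm (f - g n) @[n --> \oo] --> (0 : R) -> trig_closure f.
Proof.
move=> gT fg e e0; have e40 : 0 < e / 4 by rewrite divr_gt0.
have /cvgrPdist_lt/(_ _ e40)[N _ /(_ N)] := fg.
rewrite /= leqnn sub0r normrN ger0_norm ?hnorm_ge0// => /(_ isT) fgN.
have [p pT gp] := gT N _ e40; exists p => //.
by apply: le_lt_trans (hnormD2_le f (g N) p) _; lra.
Qed.

(** Working with multipliers instead of elements of the closure gives an algebra:
   it contains products, and hence polynomials, of its elements. *)
Definition trig_multiplier b := bounded_mfun b /\
  forall f, trig_closure f -> trig_closure (bmul b f).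

Lemma trig_multiplier_cst (a : R[i]) : trig_multiplier (fun=> a).
Proof.
split=> [|f fT]; first exact: bounded_mfun_cst.
rewrite bmul_cst -[_ *: _]addr0; apply: trig_closure_lin => //.
exact/trig_closure_poly/trigpoly0.
Qed.

Lemma trig_multiplierD b c : trig_multiplier b -> trig_multiplier c ->
  trig_multiplier (fun t => b t + c t).
Proof.
move=> [bb bT] [bc cT]; split=> [|f fT]; first exact: bounded_mfunD.
by rewrite bmulDl// -[bmul b f]scale1r; apply: trig_closure_lin; auto.
Qed.

Lemma trig_multiplierM b c : trig_multiplier b -> trig_multiplier c ->
  trig_multiplier (fun t => b t * c t).
Proof.
move=> [bb bT] [bc cT]; split=> [|f fT]; first exact: bounded_mfunM.
by rewrite -bmulA//; auto.
Qed.

Lemma trig_multiplierX b n : trig_multiplier b ->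
  trig_multiplier (fun t => b t ^+ n).
Proof.
move=> bT; elim: n => [|n IH]; first exact: trig_multiplier_cst.
rewrite (_ : (fun t => _) = fun t => b t * b t ^+ n).
  exact: trig_multiplierM.
by apply/funext => t; rewrite exprS.
Qed.

Lemma trig_multiplier_expi (n : int) :
  trig_multiplier (fun t => expi (n%:~R * t)).
Proof.
have mm := @expi_mfun R n%:~R.
split=> [//|f fT e e0]; have [p pT fp] := fT e e0.
exists (bmul (fun t => expi (n%:~R * t)) p); first exact: trigpoly_bmul.
rewrite -bmulB// hnorm_bmul//; apply: aeW => t; exact: expiV.
Qed.

(** If b_n tends boundedly to b, then b_n f tends to b f in L^2, being dominated
   by a multiple of f. *)
Lemma trig_multiplier_lim (b_ : nat -> R -> R[i]) b (C : R) :
  (forall n, trig_multiplier (b_ n)) -> bounded_mfun b ->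
  (forall n t, sqmod (b t - b_ n t) <= C) ->
  (forall t, sqmod (b t - b_ n t) @[n --> \oo] --> (0 : R)) ->
  trig_multiplier b.
Proof.
move=> bT bb bC b0; split=> // f fT.
apply: (@trig_closure_lim (fun n => bmul (b_ n) f)).
  by move=> n; have [_] := bT n; apply.
have hE n : {ae mu, forall t, (bmul b f - bmul (b_ n) f : L2 R) t =
    (b t - b_ n t) * f t}.
  have [bn _] := bT n.
  apply: circle_aeS2 (L2subE (bmul b f) (bmul (b_ n) f)) (circle_aeAnd (bmulE f bb) (bmulE f bn)).
  by move=> t -> [-> ->]; rewrite mulrBl.
apply: (@hnorm_dominated_cvg _ (fun t => C * sqmod (f t))).
- exact: (integrableZl measurableT C (sqmod_integrable f)).
- move=> n; apply: circle_aeS (hE n) => t ->.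
  by rewrite sqmodM ler_wpM2r ?sqmod_ge0.
- have /ae_foralln := hE; apply: circle_aeS => t ht.
  have E : (fun n => sqmod ((bmul b f - bmul (b_ n) f : L2 R) t)) =
      (fun n => sqmod (b t - b_ n t) * sqmod (f t)).
    by apply/funext => n; rewrite ht sqmodM.
  rewrite E -[X in _ --> X](mul0r (sqmod (f t))).
  by apply: cvgM; [exact: b0|exact: cvg_cst].
Qed.

Lemma trig_multiplier_ae b c : trig_multiplier b -> bounded_mfun c ->
  {ae mu, forall t, b t = c t} -> trig_multiplier c.
Proof.
move=> [bb bT] bc bec; split=> [|f fT]; first exact: bc.
by rewrite -(bmul_ae f bb bc bec); exact: bT.
Qed.

Definition rmultiplier (u : R -> R) := trig_multiplier (fun t => (u t)%:C).

Lemma rmultiplier_cst (a : R) : rmultiplier (fun=> a).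
Proof. exact: trig_multiplier_cst. Qed.

Lemma rmultiplierD u v : rmultiplier u -> rmultiplier v ->
  rmultiplier (fun t => u t + v t).
Proof.
move=> uT vT; have := trig_multiplierD uT vT.
by congr trig_multiplier; apply/funext => t; rewrite rmorphD.
Qed.

Lemma rmultiplierM u v : rmultiplier u -> rmultiplier v ->
  rmultiplier (fun t => u t * v t).
Proof.
move=> uT vT; have := trig_multiplierM uT vT.
by congr trig_multiplier; apply/funext => t; rewrite rmorphM.
Qed.

Lemma rmultiplierX u n : rmultiplier u -> rmultiplier (fun t => u t ^+ n).
Proof.
move=> uT; have := trig_multiplierX n uT.
by congr trig_multiplier; apply/funext => t; rewrite rmorphXn.
Qed.

(** The trigonometric polynomials whose level sets are the arcs of the circle. *)
Lemma rmultiplier_cos (y : R) : rmultiplier (fun t => cos (t - y)).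
Proof.
have := trig_multiplierD
  (trig_multiplierM (trig_multiplier_cst (expi (- y) / 2)) (trig_multiplier_expi 1))
  (trig_multiplierM (trig_multiplier_cst (expi y / 2)) (trig_multiplier_expi (-1))).
congr trig_multiplier; apply/funext => t.
have -> : expi (- y) / 2 * expi (1%:~R * t) = expi (t - y) / 2.
  by rewrite mulr1z mul1r mulrAC -expiD addrC.
have -> : expi y / 2 * expi ((-1)%:~R * t) = expi (- (t - y)) / 2.
  by rewrite mulrN1z mulN1r mulrAC -expiD opprB.
rewrite -mulrDl /expi cosN sinN.
have -> : (2 : R[i]) = 2%:C by rewrite rmorph_nat.
apply: (canLR (mulfK _)); first by rewrite eq_complex /= pnatr_eq0.
by apply/eqP; rewrite eq_complex /=; apply/andP; split; apply/eqP; ring.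
Qed.

Lemma rmultiplier_lim (u_ : nat -> R -> R) (u : measurableTypeR R -> R) (M : R) :
  (forall n, rmultiplier (u_ n)) -> measurable_fun setT u ->
  (forall t, `|u t| <= M) -> (forall n t, `|u_ n t| <= M) ->
  (forall t, u_ n t @[n --> \oo] --> u t) -> rmultiplier u.
Proof.
move=> uT mu' uM unM uu.
have sq n t : sqmod ((u t)%:C - (u_ n t)%:C) = (u t - u_ n t) ^+ 2.
  by rewrite /sqmod -rmorphB /= expr0n addr0.
apply: (@trig_multiplier_lim (fun n t => (u_ n t)%:C) _ ((M + M) ^+ 2)) => //.
- exact: bounded_mfun_real mu' uM.
- move=> n t; rewrite sq -real_normK ?num_real// ler_pXn2r ?nnegrE//.
    by apply: (le_trans (ler_normB _ _)); rewrite lerD.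
  by rewrite addr_ge0// (le_trans _ (uM 0)).
- move=> t; rewrite (_ : (fun n => _) = (fun n => (u t - u_ n t) ^+ 2)).
    rewrite -[X in _ --> X](expr0n R 2) -(subrr (u t)).
    by rewrite expr2; under eq_fun do rewrite expr2; apply: cvgM; apply: cvgB => //; exact: cvg_cst.
  by apply/funext => n; rewrite sq.
Qed.

(** Measurability is kept in the definition so that these sets form a sigma-algebra
   contained in the Borel one. *)
Definition trig_set (A : set (measurableTypeR R)) :=
  measurable A /\ rmultiplier (\1_A : R -> R).

(** The functions (1 - u^n)^(n 2^n) are multipliers, bounded by 1, and tend to the
   indicator of the level set. *)
Lemma trig_set_level (u : measurableTypeR R -> R) : measurable_fun setT u ->
  rmultiplier u -> (forall t, 0 <= u t <= 1) -> trig_set [set t | u t < 2^-1].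
Proof.
move=> mu' uT u01.
have mA : measurable [set t : measurableTypeR R | u t < 2^-1].
  rewrite (_ : [set _ | _] = setT `&` u @^-1` `]-oo, 2^-1[%classic).
    exact: mu'.
  by apply/seteqP; split=> t /=; rewrite in_itv/=; [split|case].
split; first exact: mA.
apply: (@rmultiplier_lim (fun n t => (1 - u t ^+ n) ^+ (n * 2 ^ n)) _ 1).
- move=> n; apply: rmultiplierX; apply: rmultiplierD; first exact: rmultiplier_cst.
  rewrite (_ : (fun t => _) = fun t => -1 * u t ^+ n).
    by apply: rmultiplierM; [exact: rmultiplier_cst|exact: rmultiplierX].
  by apply/funext => t; rewrite mulN1r.
- exact: measurable_indic.
- by move=> t; rewrite ger0_norm// indicE; case: (_ \in _).
- move=> n t; have /andP[u0 u1] := u01 t.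
  have un : 0 <= 1 - u t ^+ n by rewrite subr_ge0 exprn_ile1.
  rewrite ger0_norm ?exprn_ge0// exprn_ile1// gerBl exprn_ge0//.
- move=> t; rewrite indicE.
  have -> : (t \in [set t | u t < 2^-1]) = (u t < 2^-1).
    by apply/idP/idP; rewrite inE.
  exact: pow_indicator_cvg.
Qed.

Lemma trig_setC A : trig_set A -> trig_set (~` A).
Proof.
move=> [mA AT]; split; first exact: measurableC.
rewrite (_ : \1_(~` A) = (fun t => 1 + -1 * \1_A t)).
  apply: rmultiplierD; first exact: rmultiplier_cst.
  by apply: rmultiplierM; [exact: rmultiplier_cst|exact: AT].
apply/funext => t; rewrite !indicE in_setC.
by case: (_ \in A); rewrite mulN1r/= ?subrr ?subr0.
Qed.

Lemma trig_setI A B : trig_set A -> trig_set B -> trig_set (A `&` B).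
Proof.
move=> [mA AT] [mB BT]; split; first exact: measurableI.
by rewrite indicI; exact: rmultiplierM.
Qed.

Lemma trig_set_bigcup (F : nat -> set (measurableTypeR R)) :
  (forall n, trig_set (F n)) -> trig_set (\bigcup_n F n).
Proof.
move=> FT; have mF n : measurable (F n) by have [] := FT n.
have UT n : trig_set (\big[setU/set0]_(i < n) F i).
  elim: n => [|n IH]; rewrite ?big_ord0 ?big_ord_recr/=.
    split=> //; rewrite indic0; exact: rmultiplier_cst.
  rewrite -[_ `|` _]setCK setCU; apply: trig_setC; apply: trig_setI; apply: trig_setC.
    exact: IH.
  exact: FT.
have mU : measurable (\bigcup_n F n) by exact: bigcup_measurable.
split; first exact: mU.
apply: (@rmultiplier_lim (fun n => \1_(\big[setU/set0]_(i < n) F i)) _ 1).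
- by move=> n; have [] := UT n.
- exact: measurable_indic.
- by move=> t; rewrite ger0_norm// indicE; case: (_ \in _).
- by move=> n t; rewrite ger0_norm// indicE; case: (_ \in _).
move=> t; have [[k _ Fkt]|nFt] := pselect ((\bigcup_n F n) t).
  apply: cvg_near_cst.
  near=> n; rewrite !indicE !mem_set//; first by exists k.
  rewrite -bigcup_mkord; exists k => //=; near: n; exact: nbhs_infty_gt.
rewrite indicE memNset//.
rewrite (_ : (fun n => _) = (fun=> 0)); first exact: cvg_cst.
apply/funext => n; rewrite indicE memNset//.
by rewrite -bigcup_mkord => -[k _ Fkt]; apply: nFt; exists k.
Unshelve. all: by end_near. Qed.

End trig_multipliers.

(** * Density of the trigonometric polynomials *)

Section trig_density.
Variable R : realType.
Local Notation mu := (@circle_measure R).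
Local Notation Re := (@complex.Re R).
Local Notation Im := (@complex.Im R).
Implicit Types (b c F : R -> R[i]) (f g : L2 R).

Lemma circle_ae_itv : {ae mu, forall t, 0 < t < 2 * pi}.
Proof.
exists (~` `]0, 2 * pi[%classic); split.
- by apply: measurableC; exact: measurable_itv.
- rewrite /circle_measure /uniform_prob integral_uniform_pdf.
  apply: null_set_integral.
  + by apply: measurableI; [by apply: measurableC; exact: measurable_itv|exact: measurable_itv].
  + apply/measurable_EFinP/measurable_funTS; exact: measurable_uniform_pdf.
  + have -> : ~` `]0, 2 * pi[%classic `&` `[0, 2 * pi]%classic = [set 0; 2 * pi : R].
      apply/seteqP; split=> t /=; rewrite !in_itv/=.
        move=> [/negP + /andP[t0 t1]]; rewrite negb_and -!leNgt => /orP[tn|tn].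
          by left; apply/eqP; rewrite eq_le t0 tn.
        by right; apply/eqP; rewrite eq_le t1 tn.
      have p0 := pi_gt0 R.
      by move=> [->|->]; rewrite !lexx ?ltxx ?andbF ?mulr_ge0//= ltW.
    by apply: null_set_setU => //; exact: lebesgue_measure_set1.
by move=> t /= nt; rewrite in_itv.
Qed.

Lemma trig_set_ae (A B : set (measurableTypeR R)) : trig_set A -> measurable B ->
  {ae mu, forall t, A t <-> B t} -> trig_set B.
Proof.
move=> [mA AT] mB AB; split; [exact: mB|apply: (trig_multiplier_ae AT)].
  apply: (@bounded_mfun_real _ _ 1); first exact: measurable_indic.
  by move=> t; rewrite ger0_norm// indicE; case: (_ \in _).
move: AB; apply: circle_aeS => t ABt; congr (_%:C); rewrite !indicE.
by congr (_%:R); congr nat_of_bool; apply/idP/idP; rewrite !inE; apply ABt.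
Qed.

(** On (0, 2 pi) one has cos (t - x/2) - cos (x/2) = 2 sin (t/2) sin ((x-t)/2),
   which is positive exactly when t < x; up to a null set, the ray is thus a level
   set of a trigonometric polynomial. *)
Lemma trig_set_ray (x : R) : trig_set `]-oo, x[%classic.
Proof.
have p0 := pi_gt0 R.
have mx : measurable (`]-oo, x[%classic : set (measurableTypeR R)) by exact: measurable_itv.
have [x0|x0] := leP x 0.
  apply: (@trig_set_ae set0) => //.
    by split=> //; rewrite indic0; exact: rmultiplier_cst.
  apply: circle_aeS circle_ae_itv => t /andP[t0 _]; split=> //=.
  by rewrite in_itv/= => tx; have := lt_trans tx (le_lt_trans x0 t0); rewrite ltxx.
have [x1|x1] := leP (2 * pi) x.
  apply: (@trig_set_ae setT) => //.
    by split=> //; rewrite indicT; exact: rmultiplier_cst.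
  apply: circle_aeS circle_ae_itv => t /andP[_ t1]; split=> // _ /=.
  by rewrite in_itv/= (lt_le_trans t1).
(* The factor 1/4 brings the values of u into [0, 1]. *)
pose u (t : measurableTypeR R) : R := 2^-1 + (-(4^-1)) * (cos (t - x / 2) + (- cos (x / 2))).
apply: (@trig_set_ae [set t | u t < 2^-1]) => //.
  apply: trig_set_level.
  - apply: measurable_funD => //; apply: measurable_funM => //.
    apply: measurable_funD => //.
    apply: (measurableT_comp (continuous_measurable_fun (@continuous_cos R))).
    exact: measurable_funD.
  - apply: rmultiplierD; first exact: rmultiplier_cst.
    apply: rmultiplierM; first exact: rmultiplier_cst.
    apply: rmultiplierD; last exact: rmultiplier_cst.
    exact: rmultiplier_cos.
  - move=> t; rewrite /u; have := cos_le1 (t - x / 2); have := cos_geN1 (t - x / 2).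
    have := cos_le1 (x / 2); have := cos_geN1 (x / 2); lra.
apply: circle_aeS circle_ae_itv => t /andP[t0 t1].
have E : cos (t - x / 2) - cos (x / 2) = 2 * sin (t / 2) * sin ((x - t) / 2).
  have -> : t - x / 2 = t / 2 - (x - t) / 2 by field.
  have -> : x / 2 = t / 2 + (x - t) / 2 by field.
  by rewrite cosB cosD; ring.
have st : 0 < sin (t / 2) by rewrite sin_gt0_pi//; lra.
rewrite /= in_itv/= /u E; split=> [h|tx].
  rewrite ltNge; apply/negP => xt.
  have : 0 <= sin ((t - x) / 2) by rewrite sin_ge0_pi//; lra.
  have -> : (t - x) / 2 = - ((x - t) / 2) by field.
  rewrite sinN; move: h st; move: (sin _) (sin _) => a b h a0 b0.
  have ab : 0 < a * b by lra.
  by nra.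
have : 0 < sin ((x - t) / 2) by rewrite sin_gt0_pi//; lra.
by move: st => /mulr_gt0 /[apply]; lra.
Qed.

(** The rays generate the Borel sets. *)
Lemma trig_set_measurable (A : set (measurableTypeR R)) : measurable A -> trig_set A.
Proof.
move=> mA; have : (@ocitv R).-sigma.-measurable A by exact: mA.
rewrite RGenInftyO.measurableE; apply: smallest_sub => [|_ [x ->]]; last exact: trig_set_ray.
split.
- by split=> //; rewrite indic0; exact: rmultiplier_cst.
- by move=> B BT; rewrite setTD; exact: trig_setC.
- exact: trig_set_bigcup.
Qed.

Lemma rmultiplier_sum (I : Type) (r : seq I) (u : I -> R -> R) :
  (forall i, rmultiplier (u i)) -> rmultiplier (fun t => \sum_(i <- r) u i t).
Proof.
move=> uT; elim: r => [|i r IH].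
  under eq_fun do rewrite big_nil; exact: rmultiplier_cst.
by under eq_fun do rewrite big_cons; exact: rmultiplierD.
Qed.

Lemma rmultiplier_simple (s : {fimfun (measurableTypeR R) >-> R}) :
  measurable_fun setT s -> rmultiplier s.
Proof.
move=> ms.
have [n [c [B [mB sE]]]] : exists n (c : 'I_n -> R) (B : 'I_n -> set (measurableTypeR R)),
    (forall i, measurable (B i)) /\ forall x, s x = \sum_i c i * \1_(B i) x.
  do 3 eexists; split; last exact: (fimfunEord s).
  by move=> i; rewrite -[X in measurable X]setTI; apply: ms.
rewrite (_ : (s : R -> R) = fun x => \sum_i c i * \1_(B i) x); last exact/funext.
apply: rmultiplier_sum => i; apply: rmultiplierM; first exact: rmultiplier_cst.
by have [] := trig_set_measurable (mB i).
Qed.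

Import HBNNSimple.

(** A bounded nonnegative function is the limit of an increasing sequence of
   simple functions. *)
Lemma rmultiplier_ge0 (u : measurableTypeR R -> R) (M : R) : measurable_fun setT u ->
  (forall t, 0 <= u t <= M) -> rmultiplier u.
Proof.
move=> mu' uM; have mEu : measurable_fun setT (EFin \o u) by exact/measurable_EFinP.
have u0 t : setT t -> (0 <= (EFin \o u) t)%E.
  by move=> _; rewrite lee_fin; have /andP[] := uM t.
pose s n := nnsfun_approx measurableT mEu n.
apply: (rmultiplier_lim (u_ := fun n => s n : R -> R) (M := M)) => //.
- by move=> n; apply: rmultiplier_simple.
- by move=> t; have /andP[t0 t1] := uM t; rewrite ger0_norm.
- move=> n t; have /andP[t0 t1] := uM t; rewrite ger0_norm//.
  apply: (le_trans _ t1); rewrite -lee_fin /s nnsfun_approxE.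
  exact: le_approx.
- by move=> t; have /fine_cvg := cvg_nnsfun_approx measurableT mEu u0 (x := t) I.
Qed.

Lemma bounded_trig_multiplier b : bounded_mfun b -> trig_multiplier b.
Proof.
move=> [b1 b2 [M bM]].
have rM (u : measurableTypeR R -> R) : measurable_fun setT u ->
    (forall t, `|u t| <= M) -> rmultiplier u.
  move=> mu' uM; rewrite (_ : u = fun t => (u t + M) + (- M)).
    apply: rmultiplierD; last exact: rmultiplier_cst.
    apply: (@rmultiplier_ge0 (fun t => u t + M) (M + M)).
      exact: measurable_funD.
    by move=> t; have := uM t; rewrite ler_norml; lra.
  by apply/funext => t; rewrite addrK.
have B1 := rM _ b1 (fun t => (bM t).1); have B2 := rM _ b2 (fun t => (bM t).2).
have := trig_multiplierD B1 (trig_multiplierM (trig_multiplier_cst 'i%C) B2).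
by congr trig_multiplier; apply/funext => t; rewrite -complexE.
Qed.

(** Bounded functions are multipliers applied to the constant 1; a general f is
   the limit of its truncations to the sets where |f|^2 <= n. *)
Theorem trig_closure_L2 f : trig_closure f.
Proof.
have [f1 f2] : measurable_fun setT (Re \o f : measurableTypeR R -> R) /\
    measurable_fun setT (Im \o f : measurableTypeR R -> R).
  have /L2predP[] := valP (L2repr f).
  by move=> /andP[/[!inE] ? _] /andP[/[!inE] ? _].
pose A n := [set t : measurableTypeR R | sqmod (f t) <= n%:R].
have mA n : measurable (A n).
  rewrite (_ : A n = setT `&` (fun t : measurableTypeR R => sqmod (f t)) @^-1` `]-oo, n%:R]%classic).
    have : measurable_fun setT (fun t : measurableTypeR R => sqmod (f t)).
      by apply: measurable_funD; apply: measurable_funX.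
    by apply.
  by apply/seteqP; split=> t /=; rewrite in_itv/=; [split|case].
pose b n t : R[i] := (\1_(A n) t)%:C * f t.
have bb n : bounded_mfun (b n).
  split.
  - rewrite (_ : _ \o _ = (\1_(A n) : measurableTypeR R -> R) \* (Re \o f)).
      by apply: measurable_funM.
    by apply/funext => t; rewrite /= /b; case: (f t) => x y /=; rewrite mul0r subr0.
  - rewrite (_ : _ \o _ = (\1_(A n) : measurableTypeR R -> R) \* (Im \o f)).
      by apply: measurable_funM.
    by apply/funext => t; rewrite /= /b; case: (f t) => x y /=; rewrite mul0r addr0.
  exists (n%:R + 1) => t; rewrite /b indicE.
  case: (boolP (t \in A n)) => [|_]; last by rewrite mul0r normr0; split; exact: ltW.
  rewrite inE /A /= mul1r /sqmod => h.
  have n0 : (0 : R) <= n%:R by [].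
  by rewrite !ler_norml; split; apply/andP; split; nra.
pose one := zpow R 0.
have oneE : {ae mu, forall t, one t = 1}.
  by apply: circle_aeS (zpowE R 0) => t ->; rewrite mul0r expi0.
have fn n : {ae mu, forall t, (f - bmul (b n) one : L2 R) t = (1 - (\1_(A n) t)%:C) * f t}.
  have := circle_aeAnd (bmulE one (bb n)) oneE.
  apply: circle_aeS2 (L2subE f (bmul (b n) one)) => t -> [-> ->].
  by rewrite mulr1 /b mulrBl mul1r.
apply: (trig_closure_lim (g := fun n => bmul (b n) one)).
  move=> n; have [_] := bounded_trig_multiplier (bb n); apply.
  apply: trig_closure_poly; rewrite -[one]scale1r -[_ *: _]addr0.
  exact/trigpoly_cons/trigpoly0.
apply: (hnorm_dominated_cvg (G := fun t => sqmod (f t))).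
- exact: sqmod_integrable.
- move=> n; apply: circle_aeS (fn n) => t ->; rewrite indicE.
  case: (t \in A n); rewrite ?subrr ?subr0 ?mul0r ?mul1r//.
  by rewrite {1}/sqmod /= expr0n addr0 sqmod_ge0.
- have /ae_foralln := fn; apply: circle_aeS => t ht.
  apply: cvg_near_cst; near=> n.
  rewrite ht indicE mem_set ?subrr ?mul0r /A /=.
    by rewrite /sqmod /= expr0n addr0.
  have := archi_boundP (sqmod_ge0 (f t)) => /ltW /le_trans; apply.
  by rewrite ler_nat; near: n; exact: nbhs_infty_ge.
Unshelve. all: by end_near. Qed.

End trig_density.

(** * Integrals of complex functions over an interval *)

Section interval_integral.
Variable R : realType.
Local Notation leb := (@lebesgue_measure R).
Local Notation Re := (@complex.Re R).
Local Notation Im := (@complex.Im R).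
Local Notation rint a b u := (\int[leb]_(x in `[a, b]) u x).
Implicit Types (a b c : R) (u v : R -> R) (F G : R -> R[i]).

(** Continuity of u on the whole line at each point of the interval, stronger than
   continuity of the restriction, is what the integrands met below satisfy. *)
Definition continuous_on a b u := forall x, a <= x <= b -> {for x, continuous u}.

Lemma continuous_on_integrable a b u : continuous_on a b u ->
  leb.-integrable `[a, b] (EFin \o u).
Proof.
move=> cu; apply: continuous_compact_integrable; first exact: segment_compact.
apply: continuous_in_subspaceT => x; rewrite inE /= in_itv/= => xab.
exact: cu.
Qed.

Lemma Rintegral_itv_split a c b u : a <= c <= b -> continuous_on a b u ->
  rint a b u = rint a c u + rint c b u.
Proof.
move=> /andP[ac cb] cu; have iu := continuous_on_integrable cu.
have ic : leb.-integrable `]c, b] (EFin \o u).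
  apply: integrableS iu => //.
  by move=> x /=; rewrite !in_itv/= => /andP[/ltW/(le_trans ac) -> ->].
apply/eqP; rewrite addrC -subr_eq; apply/eqP.
rewrite Rintegral_itvB//; [|by rewrite bnd_simp..].
exact: Rintegral_itv_obnd_cbnd.
Qed.

Lemma Rintegral_FTC a b u (U : R -> R) : a <= b ->
  (forall x : R, is_derive x 1 U (u x)) -> continuous_on a b u ->
  rint a b u = U b - U a.
Proof.
move=> ab dU cu; move: ab; rewrite le_eqVlt => /predU1P[->|ab].
  by rewrite set_itv1 Rintegral_set1 subrr.
rewrite /Rintegral (@continuous_FTC2 _ _ U)//.
- apply: continuous_in_subspaceT => x; rewrite inE /= in_itv/=; exact: cu.
- have cU x : {for x, continuous U}.
    by apply/differentiable_continuous/derivable1_diffP; have [] := dU x.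
  split; first by move=> x _; have [] := dU x.
  + exact/cvg_at_right_filter/cU.
  + exact/cvg_at_left_filter/cU.
by move=> x _; rewrite derive1E derive_val.
Qed.

Lemma le_Rintegral_itv a b u (M : R) : a <= b -> continuous_on a b u ->
  (forall x, a <= x <= b -> `|u x| <= M) -> `|rint a b u| <= M * (b - a).
Proof.
move=> ab cu uM; have iu := continuous_on_integrable cu.
have mab : measurable (`[a, b]%classic : set (measurableTypeR R)) by exact: measurable_itv.
have fab : lebesgue_measure (`[a, b]%classic : set R) = (b - a)%:E.
  rewrite lebesgue_measure_itv/= lte_fin; case: ltP => // ba.
  have -> : b = a by apply/eqP; rewrite eq_le ba ab.
  by rewrite subrr.
apply: (le_trans (le_normr_Rintegral _ _)) => //.
have -> : M * (b - a) = rint a b (fun=> M).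
  by rewrite Rintegral_cst//; congr (_ * _); exact: (esym (congr1 fine fab)).
apply: le_Rintegral => //.
- by apply: continuous_on_integrable => x xab; apply: cvg_norm; exact: cu.
- by apply: continuous_on_integrable => x _; exact: cvg_cst.
Qed.

Definition ccont_on a b F := continuous_on a b (Re \o F) /\ continuous_on a b (Im \o F).

Definition cint a b F : R[i] :=
  rint a b (fun x => Re (F x)) +i* rint a b (fun x => Im (F x)).

Lemma cint_split a c b F : a <= c <= b -> ccont_on a b F ->
  cint a b F = cint a c F + cint c b F.
Proof.
move=> acb [c1 c2].
by rewrite /cint (Rintegral_itv_split acb c1) (Rintegral_itv_split acb c2).
Qed.

Lemma cint_FTC a b F (P Q : R -> R) : a <= b ->
  (forall x : R, is_derive x 1 P (Re (F x))) -> (forall x : R, is_derive x 1 Q (Im (F x))) ->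
  ccont_on a b F -> cint a b F = (P b - P a) +i* (Q b - Q a).
Proof.
by move=> ab dP dQ [c1 c2]; rewrite /cint (Rintegral_FTC ab dP)// (Rintegral_FTC ab dQ).
Qed.

Lemma normc_le_ReIm (z : R[i]) : normc z <= `|Re z| + `|Im z|.
Proof.
case: z => x y /=.
rewrite -[leRHS]ger0_norm ?addr_ge0// -sqrtr_sqr ler_wsqrtr//.
rewrite sqrrD !real_normK ?num_real// lerD2r lerDl mulrn_wge0//.
Qed.

Lemma le_Re_normc (z : R[i]) : `|Re z| <= normc z.
Proof.
by case: z => x y /=; rewrite -sqrtr_sqr ler_wsqrtr// lerDl sqr_ge0.
Qed.

Lemma le_Im_normc (z : R[i]) : `|Im z| <= normc z.
Proof.
by case: z => x y /=; rewrite -sqrtr_sqr ler_wsqrtr// lerDr sqr_ge0.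
Qed.

Lemma normc_nneg (z : R[i]) : 0 <= normc z.
Proof. exact: le_trans (le_Re_normc z). Qed.

Lemma le_cint a b F (M : R) : a <= b -> ccont_on a b F ->
  (forall x, a <= x <= b -> normc (F x) <= M) ->
  normc (cint a b F) <= 2 * M * (b - a).
Proof.
move=> ab [c1 c2] FM; apply: (le_trans (normc_le_ReIm _)).
rewrite -mulrA mulr2n mulrDl mul1r; apply: lerD; apply: le_Rintegral_itv => // x xab.
  exact: le_trans (le_Re_normc _) (FM x xab).
exact: le_trans (le_Im_normc _) (FM x xab).
Qed.

Lemma continuous_onD a b u v : continuous_on a b u -> continuous_on a b v ->
  continuous_on a b (fun x => u x + v x).
Proof. by move=> cu cv x xab; apply: cvgD; [exact: cu|exact: cv]. Qed.

Lemma continuous_onB a b u v : continuous_on a b u -> continuous_on a b v ->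
  continuous_on a b (fun x => u x - v x).
Proof. by move=> cu cv x xab; apply: cvgB; [exact: cu|exact: cv]. Qed.

Lemma continuous_onM a b u v : continuous_on a b u -> continuous_on a b v ->
  continuous_on a b (fun x => u x * v x).
Proof. by move=> cu cv x xab; apply: cvgM; [exact: cu|exact: cv]. Qed.

Lemma continuous_on_cst a b (k : R) : continuous_on a b (fun=> k).
Proof. by move=> x _; exact: cvg_cst. Qed.

Lemma ccont_onM a b F G : ccont_on a b F -> ccont_on a b G ->
  ccont_on a b (fun x => F x * G x).
Proof.
move=> [F1 F2] [G1 G2]; split.
  rewrite (_ : _ \o _ = fun x => Re (F x) * Re (G x) - Im (F x) * Im (G x)).
    by apply: continuous_onB; exact: continuous_onM.
  by apply/funext => x; exact: complex_ReM.
rewrite (_ : _ \o _ = fun x => Re (F x) * Im (G x) + Im (F x) * Re (G x)).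
  by apply: continuous_onD; exact: continuous_onM.
by apply/funext => x; exact: complex_ImM.
Qed.

Lemma ccont_on_cst a b (k : R[i]) : ccont_on a b (fun=> k).
Proof. by split; exact: continuous_on_cst. Qed.

Lemma ccont_on_real a b u : continuous_on a b u -> ccont_on a b (fun x => (u x)%:C).
Proof. by move=> cu; split => //; exact: continuous_on_cst. Qed.

Lemma ccont_on_expi a b (k : R) : ccont_on a b (fun x => expi (k * x)).
Proof.
have ck (x : R) : {for x, continuous (fun x : R => k * x)}.
  by apply: cvgM; [exact: cvg_cst|exact: cvg_id].
by split=> x _; apply: continuous_comp (ck x) _; [exact: continuous_cos|exact: continuous_sin].
Qed.

Lemma cint_lin a b (k : R[i]) F G : ccont_on a b F -> ccont_on a b G ->
  cint a b (fun x => k * F x + G x) = k * cint a b F + cint a b G.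
Proof.
move=> [F1 F2] [G1 G2].
have mab : measurable (`[a, b]%classic : set (measurableTypeR R)) by exact: measurable_itv.
have L (p q : R) u v w : continuous_on a b u -> continuous_on a b v -> continuous_on a b w ->
    rint a b (fun x => p * u x + q * v x + w x) =
    p * rint a b u + q * rint a b v + rint a b w.
  move=> cu cv cw.
  have cpu : continuous_on a b (fun x => p * u x).
    by apply: continuous_onM => //; exact: continuous_on_cst.
  have cqv : continuous_on a b (fun x => q * v x).
    by apply: continuous_onM => //; exact: continuous_on_cst.
  have cuv := continuous_onD cpu cqv.
  rewrite RintegralD//; [|exact: continuous_on_integrable..].
  rewrite RintegralD//; [|exact: continuous_on_integrable..].
  by rewrite !RintegralZl//; exact: continuous_on_integrable.
case: k => p q; apply/eqP; rewrite eq_complex /=; apply/andP; split; apply/eqP.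
  rewrite -mulNr -L//; apply: eq_Rintegral => x _ /=.
  by case: (F x) (G x) => ? ? [? ?] /=; ring.
rewrite [X in X + _]addrC -L//; apply: eq_Rintegral => x _ /=.
by case: (F x) (G x) => ? ? [? ?] /=; ring.
Qed.

Lemma eq_cint a b F G : (forall x, a <= x <= b -> F x = G x) -> cint a b F = cint a b G.
Proof.
by move=> FG; congr (_ +i* _); apply: eq_Rintegral => x; rewrite inE/= in_itv/= => /FG ->.
Qed.

End interval_integral.

(** * Integrals around polar rectangles *)

Section goursat.
Variable R : realType.
Local Notation Re := (@complex.Re R).
Local Notation Im := (@complex.Im R).
Implicit Types (a b c d : R) (g : R[i] -> R[i]).

Lemma cint_cst a b (k : R[i]) : a <= b -> cint a b (fun=> k) = k * (b - a)%:C.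
Proof.
move=> ab.
have dk (p x : R) : is_derive x 1 (fun x => p * x) p.
  by apply: is_derive_eq; rewrite /GRing.scale/= mulr1.
rewrite (@cint_FTC _ _ _ _ (fun x => Re k * x) (fun x => Im k * x))//.
  by rewrite -!mulrBr; case: k => p q /=; apply/eqP; rewrite eq_complex /=;
    apply/andP; split; apply/eqP; ring.
exact: ccont_on_cst.
Qed.

Lemma cint_scale a b (k : R[i]) F : a <= b -> ccont_on a b F ->
  cint a b (fun x => k * F x) = k * cint a b F.
Proof.
move=> ab cF; have := cint_lin k cF (ccont_on_cst a b 0).
rewrite cint_cst// mul0r addr0 => <-.
by apply: eq_cint => x _; rewrite addr0.
Qed.

Lemma cint_real_id a b : a <= b ->
  cint a b (fun x => x%:C) = ((b ^+ 2 - a ^+ 2) / 2)%:C.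
Proof.
move=> ab.
have dP (x : R) : is_derive x 1 (fun x => 2^-1 * x ^+ 2) x.
  by apply: is_derive_eq; rewrite /GRing.scale/= mulr1; field.
have dQ (x : R) : is_derive x 1 (fun=> 0 : R) 0 by exact: is_derive_cst.
rewrite (@cint_FTC _ _ _ (fun x => x%:C) _ _ ab dP dQ).
  by apply/eqP; rewrite eq_complex /= subrr eqxx andbT; apply/eqP; field.
by apply: ccont_on_real => x _; exact: cvg_id.
Qed.

Lemma cint_expi c d (k : R) : k != 0 -> c <= d ->
  'i%C * k%:C * cint c d (fun t => expi (k * t)) = expi (k * d) - expi (k * c).
Proof.
move=> k0 cd.
have ds (x : R) : is_derive x 1 (fun t => k^-1 * sin (k * t)) (cos (k * x)).
  by apply: is_derive_eq; rewrite /GRing.scale/= ?(mulr0, addr0, mulr1); field.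
have dc (x : R) : is_derive x 1 (fun t => - k^-1 * cos (k * t)) (sin (k * x)).
  by apply: is_derive_eq; rewrite /GRing.scale/= ?(mulr0, addr0, mulr1); field.
rewrite (@cint_FTC _ _ _ (fun t => expi (k * t)) _ _ cd ds dc).
2: exact: ccont_on_expi.
by apply/eqP; rewrite eq_complex /=; apply/andP; split; apply/eqP; field.
Qed.

Lemma normc_imag : normc ('i%C : R[i]) = 1.
Proof. by rewrite /= expr0n/= expr1n add0r sqrtr1. Qed.

Lemma normc_ofreal (x : R) : normc x%:C = `|x|.
Proof. by rewrite /= expr0n/= addr0 sqrtr_sqr. Qed.

Lemma normc_expi (t : R) : normc (expi t) = 1.
Proof. by rewrite /= cos2Dsin2 sqrtr1. Qed.

(** The chord is the integral of i e^{it} over the arc; the factor 2 is that of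
   le_cint, which bounds real and imaginary parts separately. *)
Lemma normc_expiB (s t : R) : normc (expi t - expi s) <= 2 * `|t - s|.
Proof.
wlog st : s t / s <= t.
  move=> h; have [|/ltW] := leP s t; first exact: h.
  by rewrite -normcN opprB distrC; exact: h.
have E : expi t - expi s = 'i%C * 1%:C * cint s t (fun t => expi (1 * t)).
  by rewrite cint_expi ?oner_neq0// !mul1r.
rewrite E !normcM normc_imag normc_ofreal normr1 !mul1r ger0_norm ?subr_ge0//.
rewrite -[X in X * (t - s)]mulr1; apply: le_cint => //; first exact: ccont_on_expi.
by move=> x _; rewrite normc_expi.
Qed.

Lemma complex_ReB (x y : R[i]) : Re (x - y) = Re x - Re y.
Proof. by case: x y => ? ? [? ?]. Qed.

Lemma complex_ImB (x y : R[i]) : Im (x - y) = Im x - Im y.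
Proof. by case: x y => ? ? [? ?]. Qed.

(** Epsilon-delta forms of continuity and of complex differentiability, with the
   modulus taken as a real number: the estimates compare it with radii, angles
   and areas of rectangles. *)
Definition ccontinuous_at g z := forall e : R, 0 < e -> exists2 d : R, 0 < d &
  forall w, normc (w - z) < d -> normc (g w - g z) < e.

Definition cderivable_at g z (k : R[i]) := forall e : R, 0 < e ->
  exists2 d : R, 0 < d & forall w, normc (w - z) < d ->
  normc (g w - g z - k * (w - z)) <= e * normc (w - z).

Lemma cderivable_continuous g z k : cderivable_at g z k -> ccontinuous_at g z.
Proof.
move=> gk e e0; have [d d0 hd] := gk 1 ltr01.
have k0 : 0 <= normc k := normc_nneg k.
have m0 : 0 < Num.min d (e / (1 + normc k)).
  by rewrite lt_min d0 divr_gt0//; lra.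
exists (Num.min d (e / (1 + normc k))) => // w; rewrite lt_min => /andP[wd we].
have -> : g w - g z = (g w - g z - k * (w - z)) + k * (w - z) by rewrite subrK.
apply: (le_lt_trans (le_normcD _ _)); rewrite normcM.
have := hd w wd; rewrite mul1r => h.
apply: (@le_lt_trans _ _ ((1 + normc k) * normc (w - z))); first lra.
by rewrite mulrC -ltr_pdivlMr//; lra.
Qed.

Lemma continuous_at_comp g (p : R -> R[i]) (x : R) : ccontinuous_at g (p x) ->
  {for x, continuous (Re \o p)} -> {for x, continuous (Im \o p)} ->
  {for x, continuous (Re \o (g \o p))} /\ {for x, continuous (Im \o (g \o p))}.
Proof.
move=> gc p1 p2.
have key (e : R) : 0 < e -> \forall y \near x, normc (g (p x) - g (p y)) < e.
  move=> e0; have [d d0 hd] := gc e e0.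
  have d2 : 0 < d / 2 by rewrite divr_gt0.
  move/cvgrPdist_lt : p1 => /(_ _ d2) n1; move/cvgrPdist_lt : p2 => /(_ _ d2) n2.
  near=> y; rewrite -normcN opprB; apply: hd; rewrite -normcN opprB.
  apply: (le_lt_trans (normc_le_ReIm _)); rewrite (splitr d) complex_ReB complex_ImB; apply: ltrD.
    by near: y.
  by near: y.
split; apply/cvgrPdist_lt => e e0; apply: filterS (key e e0) => y; apply: le_lt_trans.
  by have := le_Re_normc (g (p x) - g (p y)); rewrite complex_ReB.
by have := le_Im_normc (g (p x) - g (p y)); rewrite complex_ImB.
Unshelve. all: by end_near. Qed.

Lemma ccont_on_comp g (p : R -> R[i]) a b : ccont_on a b p ->
  (forall x, a <= x <= b -> ccontinuous_at g (p x)) ->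
  ccont_on a b (fun x => g (p x)).
Proof.
move=> [p1 p2] gp; split=> x xab.
  by have [] := continuous_at_comp (gp x xab) (p1 x xab) (p2 x xab).
by have [] := continuous_at_comp (gp x xab) (p1 x xab) (p2 x xab).
Qed.

Definition ray_integral g a b (t : R) :=
  cint a b (fun r => g (r%:C * expi t) * expi t).
Definition arc_integral g (r : R) c d :=
  cint c d (fun t => g (r%:C * expi t) * (r%:C * expi t)).
(** The integral of g(z) dz around the polar rectangle a <= r <= b, c <= t <= d:
   dz is e^{it} dr on the rays and i r e^{it} dt on the arcs. Polar coordinates
   make circles appear as sides of rectangles, and the disk of radius rho as the
   rectangle 0 <= r <= rho, 0 <= t <= 2 pi. *)
Definition loop_integral g a b c d :=
  ray_integral g a b c - ray_integral g a b d +
  'i%C * (arc_integral g b c d - arc_integral g a c d).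

Section edges.
Variables (g : R[i] -> R[i]) (rho : R).
Hypothesis gc : forall z, normc z <= rho -> ccontinuous_at g z.

Lemma normc_polar (r t : R) : 0 <= r -> normc (r%:C * expi t) = r.
Proof. by move=> r0; rewrite normcM normc_expi mulr1 normc_ofreal ger0_norm. Qed.

Lemma ray_ccont a b (t : R) : 0 <= a -> b <= rho ->
  ccont_on a b (fun r => g (r%:C * expi t) * expi t).
Proof.
move=> a0 br; apply: ccont_onM; last exact: ccont_on_cst.
apply: (@ccont_on_comp g (fun r => r%:C * expi t)).
  by apply: ccont_onM; [apply: ccont_on_real => x _; exact: cvg_id|exact: ccont_on_cst].
move=> r /andP[ar rb]; apply: gc.
by rewrite normc_polar ?(le_trans rb)// (le_trans a0).
Qed.

Lemma arc_ccont (r : R) c d : 0 <= r <= rho ->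
  ccont_on c d (fun t => g (r%:C * expi t) * (r%:C * expi t)).
Proof.
move=> /andP[r0 rr].
have ce : ccont_on c d (fun t => r%:C * expi t).
  apply: ccont_onM; first exact: ccont_on_cst.
  by have := ccont_on_expi c d 1; congr ccont_on; apply/funext => t; rewrite mul1r.
apply: ccont_onM => //; apply: ccont_on_comp => // t _; apply: gc.
by rewrite normc_polar.
Qed.

(** The interior edges are traversed twice, in opposite directions. *)
Lemma loop_integral_split a m b c n d : 0 <= a -> a <= m <= b -> b <= rho ->
  c <= n <= d ->
  loop_integral g a b c d =
    (loop_integral g a m c n + loop_integral g m b c n) +
    (loop_integral g a m n d + loop_integral g m b n d).
Proof.
move=> a0 amb br cnd; have /andP[am mb] := amb.
have rs t : ray_integral g a b t = ray_integral g a m t + ray_integral g m b t.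
  by apply: cint_split => //; exact: ray_ccont.
have as_ r : 0 <= r <= rho -> arc_integral g r c d = arc_integral g r c n + arc_integral g r n d.
  by move=> rr; apply: cint_split => //; exact: arc_ccont.
rewrite /loop_integral !rs (as_ a) ?(as_ b); first by ring.
  by rewrite br andbT (le_trans a0)// (le_trans am).
by rewrite a0/= (le_trans am)// (le_trans mb).
Qed.

(** The factor 4 counts the two rays, or the two arcs, and the factor 2 of le_cint;
   b <= 1 bounds the length of the arcs by d - c. *)
Lemma le_loop_integral a b c d (M : R) : 0 <= a <= b -> b <= rho -> b <= 1 -> c <= d ->
  (forall r t, a <= r <= b -> c <= t <= d -> normc (g (r%:C * expi t)) <= M) ->
  normc (loop_integral g a b c d) <= 4 * M * ((b - a) + (d - c)).
Proof.
move=> /andP[a0 ab] br b1 cd gM.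
have M0 : 0 <= M by apply: le_trans (gM a c _ _); rewrite ?lexx ?ab ?cd ?normc_nneg.
have ray t : c <= t <= d -> normc (ray_integral g a b t) <= 2 * M * (b - a).
  move=> tcd; apply: le_cint => //; first exact: ray_ccont.
  by move=> r rab; rewrite normcM normc_expi mulr1; exact: gM.
have arc r : a <= r <= b -> normc (arc_integral g r c d) <= 2 * M * (d - c).
  move=> rab; have /andP[ar rb] := rab.
  apply: le_cint => //; first by apply: arc_ccont; rewrite (le_trans a0 ar) (le_trans rb).
  move=> t tcd; rewrite normcM normc_polar ?(le_trans a0 ar)//.
  have r0 := le_trans a0 ar; have r1 := le_trans rb b1.
  by rewrite -[leRHS]mulr1; apply: ler_pM => //; [exact: normc_nneg|exact: gM].
rewrite /loop_integral; apply: (le_trans (le_normcD _ _)).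
have h1 : normc (ray_integral g a b c - ray_integral g a b d) <= 2 * (2 * M * (b - a)).
  apply: (le_trans (le_normcD _ _)); rewrite normcN mulr2n mulrDl mul1r.
  by apply: lerD; apply: ray; rewrite lexx cd.
have h2 : normc ('i%C * (arc_integral g b c d - arc_integral g a c d)) <= 2 * (2 * M * (d - c)).
  rewrite normcM normc_imag mul1r; apply: (le_trans (le_normcD _ _)); rewrite normcN mulr2n mulrDl mul1r.
  by apply: lerD; apply: arc; rewrite lexx ab.
by lra.
Qed.

End edges.

Lemma loop_integral_lin g1 g2 rho (k : R[i]) a b c d :
  (forall z, normc z <= rho -> ccontinuous_at g1 z) ->
  (forall z, normc z <= rho -> ccontinuous_at g2 z) ->
  0 <= a -> a <= b -> b <= rho ->
  loop_integral (fun z => k * g1 z + g2 z) a b c d =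
  k * loop_integral g1 a b c d + loop_integral g2 a b c d.
Proof.
move=> c1 c2 a0 ab br.
have ray t : ray_integral (fun z => k * g1 z + g2 z) a b t =
    k * ray_integral g1 a b t + ray_integral g2 a b t.
  rewrite /ray_integral -(cint_lin k (ray_ccont c1 t a0 br) (ray_ccont c2 t a0 br)).
  by apply: eq_cint => r _; ring.
have arc r : 0 <= r <= rho -> arc_integral (fun z => k * g1 z + g2 z) r c d =
    k * arc_integral g1 r c d + arc_integral g2 r c d.
  move=> rr; rewrite /arc_integral -(cint_lin k (arc_ccont c1 c d rr) (arc_ccont c2 c d rr)).
  by apply: eq_cint => t _; ring.
rewrite /loop_integral !ray (arc a) ?(arc b); first by ring.
  by rewrite br (le_trans a0).
by rewrite a0 (le_trans ab).
Qed.

(** The primitive z takes the same value at both ends of the loop. *)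
Lemma loop_integral_cst a b c d : a <= b -> c <= d ->
  loop_integral (fun=> 1) a b c d = 0.
Proof.
move=> ab cd.
have ray t : ray_integral (fun=> 1) a b t = expi t * (b - a)%:C.
  by rewrite /ray_integral -(cint_cst _ ab); apply: eq_cint => r _; rewrite mul1r.
have arc r : 'i%C * arc_integral (fun=> 1) r c d = r%:C * (expi d - expi c).
  have E := cint_expi (oner_neq0 R) cd; rewrite !mul1r in E; rewrite -E mulr1.
  rewrite /arc_integral mulrCA -(cint_scale _ cd (ccont_on_expi c d 1)); congr (_ * _).
  by apply: eq_cint => t _; rewrite !mul1r.
rewrite /loop_integral mulrBr !arc !ray rmorphB /=.
by ring.
Qed.

(** Here the primitive is z^2 / 2. *)
Lemma loop_integral_id a b c d : a <= b -> c <= d ->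
  loop_integral id a b c d = 0.
Proof.
move=> ab cd; have two0 : (2 : R) != 0 by rewrite pnatr_eq0.
have expi2 (t : R) : expi (2 * t) = expi t ^+ 2 by rewrite mulr2n mulrDl mul1r expiD expr2.
have ray t : ray_integral id a b t = expi t ^+ 2 * ((b ^+ 2 - a ^+ 2) / 2)%:C.
  rewrite /ray_integral -(cint_real_id ab) -cint_scale//.
    by apply: eq_cint => r _; rewrite /= expr2; ring.
  by apply: ccont_on_real => x _; exact: cvg_id.
have arc r : 'i%C * arc_integral id r c d =
    (r ^+ 2 / 2)%:C * (expi d ^+ 2 - expi c ^+ 2).
  rewrite -!expi2 -(cint_expi two0 cd) /arc_integral.
  have -> : cint c d (fun t => r%:C * expi t * (r%:C * expi t)) =
      (r ^+ 2)%:C * cint c d (fun t => expi (2 * t)).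
    rewrite -(cint_scale _ cd (ccont_on_expi c d 2)); apply: eq_cint => t _.
    by rewrite expi2 rmorphXn /=; ring.
  rewrite mulrCA !mulrA; congr (_ * _); by rewrite [RHS]mulrAC -rmorphM /= divfK.
rewrite /loop_integral mulrBr !arc !ray.
by ring.
Qed.

(** Subtracting the tangent g(z0) + k (z - z0), whose loop integral vanishes,
   leaves an integrand that is small compared with the diameter of the loop; the
   length of the loop supplies the second factor of the bound. *)
Lemma loop_integral_small g rho (k : R[i]) (r0 t0 e : R) :
  (forall z, normc z <= rho -> ccontinuous_at g z) -> rho <= 1 ->
  cderivable_at g (r0%:C * expi t0) k -> 0 < e ->
  exists2 dl : R, 0 < dl & forall a b c d, 0 <= a -> a <= r0 <= b -> b <= rho ->
    c <= t0 <= d -> b - a < dl -> d - c < dl ->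
    normc (loop_integral g a b c d) <= e * ((b - a) + (d - c)) ^+ 2.
Proof.
move=> gc r1 gk e0; set z0 := r0%:C * expi t0 in gk.
have e8 : 0 < e / 8 by rewrite divr_gt0.
have [dl dl0 hd] := gk _ e8; exists (dl / 3); first by rewrite divr_gt0.
move=> a b c d a0 /andP[ar rb] br /andP[ct td] ab_small cd_small.
have ab := le_trans ar rb; have cd := le_trans ct td.
pose aff z := k * z + (g z0 - k * z0) * 1.
pose err z := -1 * aff z + g z.
have cid z : ccontinuous_at id z by move=> s s0; exists s.
have ccst (w z : R[i]) : ccontinuous_at (fun=> w) z.
  by move=> s s0; exists 1 => // y _; rewrite subrr normc0.
have clin (w : R[i]) g1 g2 z : ccontinuous_at g1 z -> ccontinuous_at g2 z ->
    ccontinuous_at (fun z => w * g1 z + g2 z) z.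
  move=> c1 c2 s s0; have w0 := normc_nneg w.
  have s1 : 0 < s / 2 / (1 + normc w) by rewrite !divr_gt0//; lra.
  have s2 : 0 < s / 2 by rewrite divr_gt0.
  have [d1 d10 h1] := c1 _ s1; have [d2 d20 h2] := c2 _ s2.
  exists (Num.min d1 d2); first by rewrite lt_min d10.
  move=> y; rewrite lt_min => /andP[y1 y2].
  have -> : w * g1 y + g2 y - (w * g1 z + g2 z) = w * (g1 y - g1 z) + (g2 y - g2 z) by ring.
  apply: (le_lt_trans (le_normcD _ _)); rewrite normcM (splitr s).
  apply: ler_ltD (h2 _ y2).
  apply: (@le_trans _ _ ((1 + normc w) * (s / 2 / (1 + normc w)))).
    by apply: ler_pM; rewrite ?normc_nneg ?(ltW (h1 _ y1))//; lra.
  by rewrite mulrC divfK// gt_eqF//; lra.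
have caff z : ccontinuous_at aff z.
  by apply: clin => //; rewrite mulr1; exact: ccst.
have cerr z : normc z <= rho -> ccontinuous_at err z.
  by move=> zr; apply: clin => //; exact: gc.
(* Constants are written as combinations of the function 1, to which linearity of
   the loop integral and loop_integral_cst apply. *)
have loop_aff : loop_integral aff a b c d = 0.
  rewrite (@loop_integral_lin id (fun=> (g z0 - k * z0) * 1) rho)//.
  rewrite loop_integral_id// mulr0 add0r.
  have -> : (fun=> (g z0 - k * z0) * 1) = (fun _ : R[i] => (g z0 - k * z0) * 1 + 0).
    by apply/funext => z; rewrite addr0.
  rewrite (@loop_integral_lin (fun=> 1) (fun=> 0) rho)// loop_integral_cst// mulr0 add0r.
  have -> : (fun=> 0) = (fun _ : R[i] => -1 * 1 + 1 : R[i]).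
    by apply/funext => z; rewrite mulN1r addNr.
  by rewrite (@loop_integral_lin (fun=> 1) (fun=> 1) rho)// loop_integral_cst// mulr0 addr0.
have <- : loop_integral err a b c d = loop_integral g a b c d.
  by rewrite (@loop_integral_lin aff g rho)// loop_aff mulr0 add0r.
set s := (b - a) + (d - c).
have M : forall r t, a <= r <= b -> c <= t <= d ->
    normc (err (r%:C * expi t)) <= e / 8 * (2 * s).
  move=> r t /andP[ar' rb'] /andP[ct' td'].
  set z := r%:C * expi t.
  have zz0 : normc (z - z0) <= (b - a) + 2 * (d - c).
    have -> : z - z0 = (r - r0)%:C * expi t + r0%:C * (expi t - expi t0).
      by rewrite /z /z0 rmorphB /=; ring.
    apply: (le_trans (le_normcD _ _)); rewrite !normcM normc_expi mulr1 !normc_ofreal.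
    apply: lerD; first by rewrite ler_norml; lra.
    apply: (@le_trans _ _ (1 * (2 * (d - c)))); last by rewrite mul1r.
    apply: ler_pM; rewrite ?normr_ge0 ?normc_nneg//.
      by rewrite ler_norml; lra.
    apply: (le_trans (normc_expiB _ _)); rewrite ler_pM2l//.
    by rewrite ler_norml; lra.
  have -> : err z = g z - g z0 - k * (z - z0) by rewrite /err /aff; ring.
  apply: (@le_trans _ _ (e / 8 * normc (z - z0))); first by apply: hd; lra.
  by rewrite ler_pM2l// /s; lra.
apply: (le_trans (le_loop_integral cerr _ br _ cd M)) => //.
- by rewrite a0.
- exact: le_trans br r1.
by rewrite -/s expr2; lra.
Qed.

End goursat.

(** * Bisection and the Cauchy theorem on circles *)

Section bisection.
Variable R : realType.

(** The bisection argument of Goursat, for a quantity N on the subrectangles of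
   [0,w] x [0,h]: if N were positive on the whole rectangle, one of the four
   quarters would carry at least a quarter of it, and so on; at the common point
   of the nested rectangles N would not be small compared with the squared
   diameter. *)
Lemma bisection (N : R -> R -> R -> R -> R) (w h : R) : 0 <= w -> 0 <= h ->
  (forall a b c d, 0 <= a -> a <= b -> b <= w -> 0 <= c -> c <= d -> d <= h ->
    N a b c d <= (N a ((a + b) / 2) c ((c + d) / 2) + N ((a + b) / 2) b c ((c + d) / 2)) +
                 (N a ((a + b) / 2) ((c + d) / 2) d + N ((a + b) / 2) b ((c + d) / 2) d)) ->
  (forall r t e : R, 0 <= r <= w -> 0 <= t <= h -> 0 < e ->
    exists2 dl : R, 0 < dl & forall a b c d, 0 <= a -> a <= r <= b -> b <= w ->
      0 <= c -> c <= t <= d -> d <= h -> b - a < dl -> d - c < dl ->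
      N a b c d <= e * ((b - a) + (d - c)) ^+ 2) ->
  N 0 w 0 h <= 0.
Proof.
move=> w0 h0 sub loc; rewrite leNgt; apply/negP => N0.
set eta := N 0 w 0 h in N0.
pose W n := w / 2 ^+ n; pose H n := h / 2 ^+ n.
have WS n : W n = W n.+1 + W n.+1 by rewrite /W exprS; field.
have HS n : H n = H n.+1 + H n.+1 by rewrite /H exprS; field.
have W_ge0 n : 0 <= W n by rewrite divr_ge0.
have H_ge0 n : 0 <= H n by rewrite divr_ge0.
pose P n (p : R * R) := [/\ 0 <= p.1, p.1 + W n <= w, 0 <= p.2, p.2 + H n <= h &
  eta / 4 ^+ n <= N p.1 (p.1 + W n) p.2 (p.2 + H n)].
have step n p : P n p -> exists q, P n.+1 q /\
    [/\ p.1 <= q.1, q.1 + W n.+1 <= p.1 + W n, p.2 <= q.2 & q.2 + H n.+1 <= p.2 + H n].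
  case: p => a c [/= a0 aw c0 ch Np].
  have := WS n; have := HS n; have := W_ge0 n.+1; have := H_ge0 n.+1 => hH hW eH eW.
  have := sub a (a + W n) c (c + H n) a0 _ aw c0 _ ch.
  have -> : (a + (a + W n)) / 2 = a + W n.+1 by rewrite eW; field.
  have -> : (c + (c + H n)) / 2 = c + H n.+1 by rewrite eH; field.
  rewrite !lerDl => /(_ (W_ge0 n) (H_ge0 n)) sN.
  have e4 : eta / 4 ^+ n = 4 * (eta / 4 ^+ n.+1) by rewrite exprS; field.
  have [N1|N1] := leP (eta / 4 ^+ n.+1) (N a (a + W n.+1) c (c + H n.+1)).
    by exists (a, c); split; [split=> //=; lra|split=> /=; lra].
  have [N2|N2] := leP (eta / 4 ^+ n.+1) (N (a + W n.+1) (a + W n) c (c + H n.+1)).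
    exists (a + W n.+1, c); split; last by split=> /=; lra.
    split=> //=; [lra|lra|lra|].
    by have -> : a + W n.+1 + W n.+1 = a + W n by lra.
  have [N3|N3] := leP (eta / 4 ^+ n.+1) (N a (a + W n.+1) (c + H n.+1) (c + H n)).
    exists (a, c + H n.+1); split; last by split=> /=; lra.
    split=> //=; [lra|lra|lra|].
    by have -> : c + H n.+1 + H n.+1 = c + H n by lra.
  exists (a + W n.+1, c + H n.+1); split; last by split=> /=; lra.
  split=> /=; [lra|lra|lra|lra|].
  have -> : a + W n.+1 + W n.+1 = a + W n by lra.
  have -> : c + H n.+1 + H n.+1 = c + H n by lra.
  lra.
have P0 : P 0%N (0, 0).
  by rewrite /P /W /H !expr0 !divr1 !add0r /=.
pose next n (p : {p | P n p}) : {p | P n.+1 p} :=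
  let q := cid (step n (sval p) (svalP p)) in exist _ (sval q) (svalP q).1.
pose s := fix s n : {p | P n p} := if n is m.+1 then next m (s m) else exist _ _ P0.
pose a n := (sval (s n)).1; pose c n := (sval (s n)).2.
have sS n : [/\ a n <= a n.+1, a n.+1 + W n.+1 <= a n + W n, c n <= c n.+1 &
    c n.+1 + H n.+1 <= c n + H n].
  exact: (svalP (cid (step n (sval (s n)) (svalP (s n))))).2.
have sP n : P n (a n, c n) by have := svalP (s n); rewrite /a /c; case: (sval _).
(* A nested sequence of intervals has a common point, the supremum of the
   left endpoints. *)
have nested (u D : nat -> R) : (forall n, 0 <= D n) -> (forall n, u n <= u n.+1) ->
    (forall n, u n.+1 + D n.+1 <= u n + D n) ->
    exists r, forall n, u n <= r <= u n + D n.
  move=> D0 uS uD.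
  have u_nd m n : (m <= n)%N -> u m <= u n.
    by move=> mn; rewrite -(subnKC mn); elim: (n - m)%N => [|k IH]; rewrite ?addn0// addnS (le_trans IH).
  have ud_ni m n : (m <= n)%N -> u n + D n <= u m + D m.
    by move=> mn; rewrite -(subnKC mn); elim: (n - m)%N => [|k IH]; rewrite ?addn0// addnS (le_trans _ IH).
  have ub m n : u m <= u n + D n.
    have [mn|/ltnW nm] := leqP m n; first by rewrite (le_trans (u_nd _ _ mn))// lerDl.
    by apply: le_trans (ud_ni _ _ nm); rewrite lerDl.
  exists (sup (range u)) => n; apply/andP; split.
    by apply: ub_le_sup; [exists (u 0%N + D 0%N) => _ [m _ <-]|exists n].
  by apply: ge_sup; [exists (u 0%N), 0%N|move=> _ [m _ <-]].
have [r rP] : exists r, forall n, a n <= r <= a n + W n.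
  by apply: nested => // n; have [] := sS n.
have [t tP] : exists t, forall n, c n <= t <= c n + H n.
  by apply: nested => // n; have [] := sS n.
have r01 : 0 <= r <= w.
  by have := rP 0%N; rewrite /a /= /W expr0 divr1 add0r.
have t01 : 0 <= t <= h.
  by have := tP 0%N; rewrite /c /= /H expr0 divr1 add0r.
(* chosen so that e (w + h)^2 < eta *)
pose e := eta / (2 * ((w + h) ^+ 2 + 1)).
have wh0 : 0 <= (w + h) ^+ 2 by exact: sqr_ge0.
have e0 : 0 < e by rewrite divr_gt0// mulr_gt0//; lra.
have [dl dl0 hd] := loc r t e r01 t01 e0.
have [n [Wn Hn]] : exists n, W n < dl /\ H n < dl.
  have : (w + h) / 2 ^+ n @[n --> \oo] --> (0 : R).
    rewrite (_ : (fun n => _) = geometric (w + h) 2^-1).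
      by apply: cvg_geometric; rewrite ger0_norm ?invr_ge0// invf_lt1// ltr1n.
    by apply/funext => n; rewrite /= exprVn.
  move=> /cvgrPdist_lt/(_ _ dl0)[n _ /(_ n)]; rewrite /= leqnn sub0r normrN => /(_ isT).
  rewrite ger0_norm ?divr_ge0 ?addr_ge0 ?exprn_ge0// => whn; exists n; split.
    by apply: le_lt_trans whn; rewrite ler_pM2r ?invr_gt0 ?exprn_gt0// lerDl.
  by apply: le_lt_trans whn; rewrite ler_pM2r ?invr_gt0 ?exprn_gt0// lerDr.
have [/= an0 anw cn0 cnh Nn] := sP n.
have := hd _ _ _ _ an0 (rP n) anw cn0 (tP n) cnh.
rewrite ![_ + _ - _]addrAC !subrr !add0r => /(_ Wn Hn) /(le_trans Nn).
have -> : (W n + H n) ^+ 2 = (w + h) ^+ 2 / 4 ^+ n.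
  have -> : (4 : R) = 2 ^+ 2 by rewrite -natrX.
  by rewrite /W /H -mulrDl exprMn exprVn -!exprM mulnC.
rewrite mulrA ler_pM2r ?invr_gt0 ?exprn_gt0// leNgt => /negP; apply.
rewrite /e mulrAC ltr_pdivrMr; last by rewrite mulr_gt0//; lra.
by rewrite ltr_pM2l//; lra.
Qed.

End bisection.

Section cauchy.
Variable R : realType.
Implicit Types g : R[i] -> R[i].

(** On the rectangle 0 <= r <= rho, 0 <= t <= 2 pi the two rays cancel by
   periodicity and the inner arc is reduced to a point, so that the loop integral
   is the integral over the circle. *)
Theorem cauchy_circle g (rho : R) : 0 <= rho -> rho <= 1 ->
  (forall z, normc z <= rho -> exists k, cderivable_at g z k) ->
  cint 0 (2 * pi) (fun t => g (rho%:C * expi t) * (rho%:C * expi t)) = 0.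
Proof.
move=> r0 r1 gk; have tp0 : (0 : R) <= 2 * pi by rewrite mulr_ge0// pi_ge0.
have gc z : normc z <= rho -> ccontinuous_at g z.
  by move=> /gk[k]; exact: cderivable_continuous.
have loop0 : loop_integral g 0 rho 0 (2 * pi) = 0.
  apply: eq0_normc; apply/eqP; rewrite eq_le normc_nneg andbT.
  apply: (@bisection R (fun a b c d => normc (loop_integral g a b c d))) => //.
  - move=> a b c d a0 ab br c0 cd dp.
    have amb : a <= (a + b) / 2 <= b by lra.
    have cnd : c <= (c + d) / 2 <= d by lra.
    rewrite (loop_integral_split gc a0 amb br cnd).
    apply: (le_trans (le_normcD _ _)); apply: lerD; exact: le_normcD.
  - move=> r t e /andP[r_ge0 rr] tt e0.
    have zr : normc (r%:C * expi t) <= rho by rewrite normc_polar.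
    have [k kz] := gk _ zr.
    have [dl dl0 hd] := loop_integral_small gc r1 kz e0.
    by exists dl => // a b c d a0 ar br c0 ct dp; exact: hd.
have expi2pi : expi (2 * pi) = expi 0 :> R[i].
  rewrite mulr2n mulrDl mul1r expiD expi0 /expi cospi sinpi.
  by apply/eqP; rewrite eq_complex /=; apply/andP; split; apply/eqP; ring.
have rays : ray_integral g 0 rho (2 * pi) = ray_integral g 0 rho 0.
  by rewrite /ray_integral expi2pi.
have arc0 : arc_integral g 0 0 (2 * pi) = 0.
  rewrite /arc_integral -(mul0r (2 * pi - 0)%:C) -(cint_cst 0 tp0).
  by apply: eq_cint => t _; rewrite mul0r mulr0.
move: loop0; rewrite /loop_integral rays subrr add0r arc0 subr0 => /eqP.
rewrite mulf_eq0 => /orP[|/eqP//].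
by rewrite eq_complex /= oner_eq0 andbF.
Qed.

End cauchy.

(** * Fourier coefficients and complex derivatives *)

Section circle_integral.
Variable R : realType.
Local Notation mu := (@circle_measure R).
Local Notation leb := (@lebesgue_measure R).
Local Notation Re := (@complex.Re R).
Local Notation Im := (@complex.Im R).
Implicit Types (F : R -> R[i]).

(** Adding the bound M to u reduces to nonnegative functions, for which the
   integral against the uniform density is a multiple of that over the interval. *)
Lemma Rintegral_circle (u : measurableTypeR R -> R) (M : R) :
  measurable_fun setT u -> (forall t, `|u t| <= M) ->
  \int[mu]_t u t = (2 * pi)^-1 * \int[leb]_(t in `[0, 2 * pi]) u t.
Proof.
move=> mu' uM; have tp0 := two_pi_gt0 R.
have tpge0 := ltW tp0.
have lebI : lebesgue_measure (`[0, 2 * pi]%classic : set R) = (2 * pi)%:E.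
  by rewrite lebesgue_measure_itv/= lte_fin tp0 sube0.
have bI (v : measurableTypeR R -> R) (K : R) : measurable_fun setT v -> (forall t, `|v t| <= K) ->
    leb.-integrable `[0, 2 * pi] (EFin \o v).
  move=> mv vK; apply: measurable_bounded_integrable.
  - exact: measurable_itv.
  - by rewrite [X in (X < _)%E]lebI ltry.
  - exact: measurable_funTS.
  - by exists K; split=> [|x Kx t _ /=]; [exact: num_real|rewrite (le_trans (vK t))// ltW].
have bmu (v : measurableTypeR R -> R) (K : R) : measurable_fun setT v -> (forall t, `|v t| <= K) ->
    mu.-integrable setT (EFin \o v).
  move=> mv vK; apply: measurable_bounded_integrable => //.
  - by rewrite [X in (X < _)%E]probability_setT ltry.
  - by exists K; split=> [|x Kx t _ /=]; [exact: num_real|rewrite (le_trans (vK t))// ltW].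
pose v t := u t + M.
have mv : measurable_fun setT (v : measurableTypeR R -> R) by exact: measurable_funD.
have v0 t : 0 <= v t by have := uM t; rewrite ler_norml /v; lra.
have vM t : `|v t| <= M + M by have := uM t; rewrite ler_norml ger0_norm// /v; lra.
have cM : forall t : R, `|M| <= `|M| by [].
have E : \int[mu]_t v t = (2 * pi)^-1 * \int[leb]_(t in `[0, 2 * pi]) v t.
  rewrite /Rintegral [X in fine X](integral_uniform (two_pi_gt0 R)); last 2 first.
  - exact/measurable_EFinP.
  - by move=> t; rewrite lee_fin.
  rewrite subr0 fineM//.
  by apply: integrable_fin_num => //; exact: (bI v (M + M) mv vM).
have E1 : \int[mu]_t v t = \int[mu]_t u t + M.
  rewrite RintegralD//; [|exact: bmu mu' uM|exact: (bmu (fun=> M) `|M|)].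
  by rewrite Rintegral_cst// [X in fine X]probability_setT mulr1.
have E2 : \int[leb]_(t in `[0, 2 * pi]) v t = \int[leb]_(t in `[0, 2 * pi]) u t + M * (2 * pi).
  rewrite RintegralD//; [|exact: bI mu' uM|exact: (bI (fun=> M) `|M|)].
  by rewrite Rintegral_cst//; congr (_ + _ * _); exact: (congr1 fine lebI).
apply: (addIr M); rewrite -E1 E E2 mulrDr [M * _]mulrC mulrA mulVf ?mul1r//.
by rewrite gt_eqF.
Qed.

Lemma cintegral_cint F : bounded_mfun F ->
  cintegral F = (2 * pi)^-1%:C * cint 0 (2 * pi) F.
Proof.
move=> [F1 F2 [M FM]]; rewrite /cintegral /cint.
rewrite (Rintegral_circle F1 (fun t => (FM t).1)).
rewrite (Rintegral_circle F2 (fun t => (FM t).2)).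
by apply/eqP; rewrite eq_complex /=; apply/andP; split; apply/eqP; ring.
Qed.

Lemma expi_period (n : int) : expi (n%:~R * (2 * pi)) = 1 :> R[i].
Proof.
have e1 : expi (2 * pi) = 1 :> R[i].
  rewrite mulr2n mulrDl mul1r expiD /expi cospi sinpi.
  by apply/eqP; rewrite eq_complex /=; apply/andP; split; apply/eqP; ring.
have en (m : nat) : expi (m%:R * (2 * pi)) = 1 :> R[i].
  elim: m => [|m IH]; first by rewrite mul0r expi0.
  by rewrite -natr1 mulrDl mul1r expiD IH e1 mulr1.
case: n => m; first exact: en.
by rewrite NegzE mulrNz mulNr -expi_conj en conjc1.
Qed.

(** The primitive e^{int} / (i n) has period 2 pi. *)
Lemma cintegral_expi (n : int) : n != 0 ->
  cintegral (fun t => expi (n%:~R * t)) = 0 :> R[i].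
Proof.
move=> n0; rewrite cintegral_cint; last exact: expi_mfun.
have nR0 : n%:~R != 0 :> R by rewrite intr_eq0.
have := cint_expi nR0 (ltW (two_pi_gt0 R)).
rewrite expi_period mulr0 expi0 subrr => /eqP.
rewrite !mulf_eq0 => /orP[/orP[|]|/eqP ->]; last by rewrite mulr0.
- by rewrite eq_complex /= oner_eq0 andbF.
- by rewrite eq_complex /= (negbTE nR0).
Qed.

Lemma ip_zpow (n m : int) : ip (zpow R n) (zpow R m) = (n == m)%:R.
Proof.
rewrite /zpow ip_class /=.
transitivity (cintegral (fun t : R => expi ((n - m)%:~R * t)) : R[i]).
  by congr cintegral; apply/funext => t; rewrite intrB mulrBl expiD -expi_conj.
have [->|nm] := eqVneq n m; last by rewrite cintegral_expi// subr_eq0.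
rewrite subrr (_ : (fun t => _) = (fun t : R => 1)); last first.
  by apply/funext => t; rewrite mul0r expi0.
rewrite /cintegral /= !Rintegral_cst// mul0r.
by rewrite [X in fine X]probability_setT mul1r.
Qed.

Lemma hnorm_zpow (n : int) : hnorm (zpow R n) = 1.
Proof. by rewrite /hnorm ip_zpow eqxx sqrtr1. Qed.

(** Multiplying the bound on the difference quotient by |w - z| also covers the
   point w = z, which the limit defining the derivative excludes. *)
Lemma derivable_cderivable (g : R[i] -> R[i]) (z : R[i]) :
  derivable (g : R[i]^o -> R[i]^o) z 1 -> exists k, cderivable_at g z k.
Proof.
move=> /cvg_ex[k gk]; exists k => e e0.
have eC : 0 < e%:C by rewrite ltcR.
move/cvgrPdist_lt : gk => /(_ _ eC).
rewrite near_withinE => /nbhs_normP[d d0 hd].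
have dE : d = (Re d)%:C by move: d0; rewrite /= ltcE => /andP[/eqP]; case: (d) => x y /= ->.
exists (Re d); first by move: d0; rewrite /= ltcE => /andP[].
move=> w wz; have [->|wz0] := eqVneq w z.
  by rewrite !subrr mulr0 subrr normc0 mulr0.
have wz0' : w - z != 0 by rewrite subr_eq0.
have := hd (w - z); rewrite /= sub0r normrN dE ltcR => /(_ wz wz0').
rewrite [_ *: 1]mulr1 subrK => h.
have -> : g w - g z - k * (w - z) = - ((k - (w - z)^-1 * (g w - g z)) * (w - z)).
  by rewrite mulrBl mulrAC mulVf// mul1r opprB.
rewrite normcN normcM ler_wpM2r ?normc_nneg//.
by apply: ltW; rewrite -ltcR.
Qed.

Lemma cderivable_mul_id (g : R[i] -> R[i]) (z k : R[i]) : cderivable_at g z k ->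
  cderivable_at (fun w => g w * w) z (k * z + g z).
Proof.
move=> gk e e0.
have z0 := normc_nneg z; have k0 := normc_nneg k.
have e1 : 0 < e / 2 / (normc z + 1) by rewrite !divr_gt0//; lra.
have e2 : 0 < e / 2 / (normc k + 1) by rewrite !divr_gt0//; lra.
have [d d0 hd] := gk _ e1.
exists (Num.min d (Num.min 1 (e / 2 / (normc k + 1)))); first by rewrite !lt_min d0 ltr01.
move=> w; rewrite !lt_min => /and3P[wd w1 we].
have -> : g w * w - g z * z - (k * z + g z) * (w - z) =
  (g w - g z - k * (w - z)) * w + (k * (w - z)) * (w - z) by ring.
apply: (le_trans (le_normcD _ _)); rewrite !normcM.
have wz1 : normc w <= normc z + 1.
  have -> : w = z + (w - z) by rewrite addrC subrK.
  by apply: (le_trans (le_normcD _ _)); lra.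
have -> : e * normc (w - z) = e / 2 * normc (w - z) + e / 2 * normc (w - z) by field.
have wz0 := normc_nneg (w - z).
apply: lerD.
  apply: (@le_trans _ _ ((e / 2 / (normc z + 1) * normc (w - z)) * (normc z + 1))).
    by apply: ler_pM; rewrite ?normc_nneg ?hd.
  by rewrite mulrAC divfK// gt_eqF//; lra.
apply: ler_wpM2r => //.
apply: (@le_trans _ _ ((normc k + 1) * (e / 2 / (normc k + 1)))).
  by apply: ler_pM; rewrite ?normc_nneg ?(ltW we)//; lra.
by rewrite mulrC divfK// gt_eqF//; lra.
Qed.

End circle_integral.

(** * Boundary values of an inner function *)

Section boundary_values.
Variable R : realType.
Local Notation mu := (@circle_measure R).
Local Notation Re := (@complex.Re R).
Local Notation Im := (@complex.Im R).
Implicit Types (F : R -> R[i]) (f g h : L2 R).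

Lemma sqmod_normc (z : R[i]) : sqmod z = normc z ^+ 2.
Proof. by case: z => x y; rewrite /sqmod /= sqr_sqrtr// addr_ge0 ?sqr_ge0. Qed.

(** The upper limit of the sequence, clipped to [-K, K] so as to be bounded even at
   the points where the sequence diverges. *)
Lemma measurable_limit (u : nat -> measurableTypeR R -> R) (K : R) : 0 <= K ->
  (forall k, measurable_fun setT (u k)) ->
  exists v : measurableTypeR R -> R, [/\ measurable_fun setT v, forall t, `|v t| <= K &
    forall t l, `|l| <= K -> u k t @[k --> \oo] --> (l : R) -> v t = l].
Proof.
move=> K0 mu_.
pose w (t : measurableTypeR R) : R := fine (limn_esup (fun k => (u k t)%:E)).
have mw : measurable_fun setT w.
  apply: (measurableT_comp (fine_measurable measurableT)).
  by apply: measurable_fun_limn_esup => k; exact/measurable_EFinP.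
exists ((fun=> - K) \max ((fun=> K) \min w)); split.
- by apply: measurable_maxr => //; exact: measurable_minr.
- move=> t /=; rewrite ler_norml le_max lexx /= ge_max ge_min lexx /= andbT; lra.
move=> t l; rewrite ler_norml => /andP[Kl lK] ul.
have -> : ((fun=> - K) \max ((fun=> K) \min w)) t = Num.max (- K) (Num.min K l).
  rewrite /= /w; congr (Num.max _ (Num.min _ _)).
  have uE : (u k t)%:E @[k --> \oo] --> l%:E by apply: cvg_EFin => //; near=> k.
  by rewrite is_cvg_limn_esupE ?(cvg_lim _ uE)//; apply/cvg_ex; exists l%:E.
by rewrite min_r// max_r.
Unshelve. all: by end_near. Qed.

Variable theta : R[i] -> R[i].
Hypothesis theta_inner : inner theta.

Lemma inner_cderivable z : normc z < 1 -> exists k, cderivable_at theta z k.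
Proof.
move=> z1; apply: derivable_cderivable; apply: (inner_holomorphic theta_inner).
by rewrite [`|z|]/((normc z)%:C) -[1]/(1%:C) ltcR.
Qed.

Definition dilation (r t : R) : R[i] := theta (r%:C * expi t).

Lemma inner_bound : exists2 M : R, 0 <= M & forall z, normc z < 1 -> normc (theta z) <= M.
Proof.
have [M hM] := inner_bounded theta_inner.
have hM' z : normc z < 1 -> normc (theta z) <= M.
  move=> z1; rewrite -lecR; apply: hM.
  by rewrite [`|z|]/((normc z)%:C) -[1]/(1%:C) ltcR.
exists M => //; apply: le_trans (normc_nneg (theta 0)) (hM' 0 _).
by rewrite normc0.
Qed.

Lemma dilation_ccont r a b : 0 <= r < 1 -> ccont_on a b (dilation r).
Proof.
move=> /andP[r0 r1].
apply: (@ccont_on_comp R theta (fun t => r%:C * expi t)) => [|t _].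
  apply: ccont_onM; first exact: ccont_on_cst.
  by have := ccont_on_expi a b 1; congr ccont_on; apply/funext => x; rewrite mul1r.
have [|k tk] := @inner_cderivable (r%:C * expi t); first by rewrite normc_polar.
exact: cderivable_continuous tk.
Qed.

Lemma dilation_mfun r : 0 <= r < 1 -> bounded_mfun (dilation r).
Proof.
move=> r01; have /andP[r0 r1] := r01.
have cd (t : R) := dilation_ccont t t r01.
have [M M0 hM] := inner_bound.
split.
- by apply: continuous_measurable_fun => t; have [+ _] := cd t; apply; rewrite lexx.
- by apply: continuous_measurable_fun => t; have [_ +] := cd t; apply; rewrite lexx.
exists M => t; have := hM (r%:C * expi t); rewrite normc_polar// => /(_ r1) h.
by split; [apply: le_trans (le_Re_normc _) h|apply: le_trans (le_Im_normc _) h].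
Qed.

Lemma expiXn (t : R) n : expi t ^+ n = expi (n%:R * t).
Proof.
elim: n => [|n IH]; first by rewrite mul0r expi0.
by rewrite exprS IH -expiD -natr1 mulrDl mul1r addrC.
Qed.

(** Up to a nonzero factor this is the integral of theta(z) z^m dz over the circle
   of radius r, and theta(z) z^m is holomorphic. *)
Lemma dilation_coef r (m : nat) : 0 < r < 1 ->
  cintegral (fun t => dilation r t * expi (m.+1%:R * t)) = 0.
Proof.
move=> /andP[r0 r1]; have r01 : 0 <= r < 1 by rewrite ltW.
rewrite cintegral_cint; last by apply: bounded_mfunM; [exact: dilation_mfun|exact: expi_mfun].
have hol z : normc z <= r -> exists k, cderivable_at (fun w => theta w * w ^+ m) z k.
  move=> zr; elim: m => [|m [k hk]].
    have [k tk] := inner_cderivable (le_lt_trans zr r1); exists k.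
    by rewrite (_ : (fun w => _) = theta)//; apply/funext => w; rewrite mulr1.
  exists (k * z + theta z * z ^+ m).
  rewrite (_ : (fun w => _) = (fun w => theta w * w ^+ m * w)).
    exact: cderivable_mul_id.
  by apply/funext => w; rewrite exprSr mulrA.
have := cauchy_circle (ltW r0) (ltW r1) hol.
have -> : cint 0 (2 * pi) (fun t => theta (r%:C * expi t) * (r%:C * expi t) ^+ m * (r%:C * expi t)) =
    (r ^+ m.+1)%:C * cint 0 (2 * pi) (fun t => dilation r t * expi (m.+1%:R * t)).
  rewrite -cint_scale; last 2 first.
  - exact: (ltW (two_pi_gt0 R)).
  - by apply: ccont_onM; [exact: dilation_ccont|exact: ccont_on_expi].
  apply: eq_cint => t _; rewrite -expiXn rmorphXn /= /dilation.
  by rewrite -mulrA -exprSr exprMn mulrCA.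
move=> /eqP; rewrite mulf_eq0 => /orP[|/eqP ->]; last by rewrite mulr0.
by rewrite eq_complex /= eqxx andbT expf_eq0 gt_eqF.
Qed.

(** Radii tending to 1 from below, and starting at 1/2 because r = 0 is excluded
   in dilation_coef. *)
Let rad k : R := 1 - k.+2%:R^-1.

Let rad01 k : 0 < rad k < 1.
Proof.
rewrite /rad subr_gt0 invf_lt1// ltr1n/= ltrBlDr ltrDl invr_gt0//.
Qed.

Let rad_cvg : rad k @[k --> \oo] --> (1 : R)^'-.
Proof.
move=> P /= hP.
have r1 : rad k @[k --> \oo] --> (1 : R).
  rewrite -[X in _ --> X]subr0; apply: cvgB; first exact: cvg_cst.
  rewrite (_ : (fun k => _) = [sequence harmonic n.+1]_n)//.
  by rewrite cvg_shiftS; exact: cvg_harmonic.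
have h : \forall k \near \oo, rad k < 1 -> P (rad k) := r1 _ hP.
change (\forall k \near \oo, P (rad k)); apply: (filterS _ h) => k; apply.
by have /andP[] := rad01 k.
Qed.

(** The radial limit is defined pointwise as a limit over all r, and may be
   arbitrary on a null set; a limit along the sequence of radii gives a measurable
   representative. Its negative Fourier coefficients are limits of those of the
   dilations, which vanish. *)
Lemma boundary_function : exists b, [/\ bounded_mfun b,
  {ae mu, forall t, b t = radial_limit theta t},
  {ae mu, forall t, b t * conjc (b t) = 1} &
  forall n : int, n < 0 -> ip (bmul b (zpow R 0)) (zpow R n) = 0].
Proof.
have rad0 k : 0 <= rad k < 1 by have /andP[/ltW -> ->] := rad01 k.
have bd k := dilation_mfun (rad0 k).
have [u [mu_ u1 ul]] := measurable_limit ler01 (fun k => bounded_mfun_Re (bd k)).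
have [v [mv v1 vl]] := measurable_limit ler01 (fun k => bounded_mfun_Im (bd k)).
pose b t : R[i] := u t +i* v t.
have bb : bounded_mfun b by split; [exact: mu_|exact: mv|exists 1 => t /=; split; [exact: u1|exact: v1]].
have bE : {ae mu, forall t, [/\ b t = radial_limit theta t, b t * conjc (b t) = 1 &
    sqmod (dilation (rad k) t - b t) @[k --> \oo] --> (0 : R)]}.
  move: (inner_unimodular theta_inner); apply: circle_aeS => t [ct l1].
  set l := radial_limit theta t in l1 *.
  have cl : (theta (r%:C * expi t) : R[i]^o) @[r --> (1 : R)^'-] --> (l : R[i]^o).
    exact: ct.
  have nl : normc l = 1.
    by have := l1; rewrite [`|_|]/((normc l)%:C) => /complexI.
  have dl (e : R) : 0 < e -> \forall k \near \oo, normc (l - dilation (rad k) t) < e.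
    move=> e0; have eC : 0 < e%:C by rewrite ltcR.
    have /cvgrPdist_lt/(_ _ eC) := cvg_comp _ _ rad_cvg cl.
    by apply: filterS => k; rewrite /= -ltcR.
  have cRe : Re (dilation (rad k) t) @[k --> \oo] --> Re l.
    apply/cvgrPdist_lt => e e0; apply: filterS (dl e e0) => k; apply: le_lt_trans.
    by rewrite -complex_ReB; exact: le_Re_normc.
  have cIm : Im (dilation (rad k) t) @[k --> \oo] --> Im l.
    apply/cvgrPdist_lt => e e0; apply: filterS (dl e e0) => k; apply: le_lt_trans.
    by rewrite -complex_ImB; exact: le_Im_normc.
  have bl : b t = l.
    rewrite /b (ul t (Re l)) ?(vl t (Im l))//.
    - by case: (l).
    - by rewrite -nl; exact: le_Im_normc.
    - by rewrite -nl; exact: le_Re_normc.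
  split=> //.
    rewrite bl; have : sqmod l = 1 by rewrite sqmod_normc nl expr1n.
    rewrite /sqmod; case: (l) => x y /= h; apply/eqP; rewrite eq_complex /=.
    by apply/andP; split; apply/eqP; [rewrite -h; ring|ring].
  have nc : normc (dilation (rad k) t - l) @[k --> \oo] --> (0 : R).
    apply/cvgrPdist_lt => e e0; apply: filterS (dl e e0) => k.
    by rewrite sub0r normrN ger0_norm ?normc_nneg// -normcN opprB.
  have E : (fun k => sqmod (dilation (rad k) t - b t)) =
      (fun k => normc (dilation (rad k) t - l) * normc (dilation (rad k) t - l)).
    by apply/funext => k; rewrite bl sqmod_normc expr2.
  by rewrite E -(mulr0 0); exact: cvgM.
exists b; split => //.
- by apply: circle_aeS bE => t [].
- by apply: circle_aeS bE => t [].
move=> n n0.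
pose one := zpow R 0.
have oneE : {ae mu, forall t, one t = 1}.
  by apply: circle_aeS (zpowE R 0) => t ->; rewrite mul0r expi0.
have dE k : {ae mu, forall t, (bmul (dilation (rad k)) one - bmul b one : L2 R) t =
    dilation (rad k) t - b t}.
  have h1 := circle_aeAnd (bmulE one (bd k)) (bmulE one bb).
  have h2 := circle_aeAnd oneE (L2subE (bmul (dilation (rad k)) one) (bmul b one)).
  by apply: circle_aeS2 h1 h2 => t [e1 e2] [e3 ->]; rewrite e1 e2 e3 !mulr1.
have [M M0 hM] := inner_bound.
have lim0 : hnorm (bmul (dilation (rad k)) one - bmul b one) @[k --> \oo] --> (0 : R).
  apply: (hnorm_dominated_cvg (G := fun=> ((M + 2) ^+ 2))).
  - exact: finite_measure_integrable_cst.
  - move=> k; apply: circle_aeS (dE k) => t ->.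
    rewrite sqmod_normc ler_pXn2r ?nnegrE ?normc_nneg//; last by rewrite addr_ge0.
    apply: (le_trans (le_normcD _ _)); rewrite normcN; apply: lerD.
      by apply: hM; rewrite normc_polar; have /andP[/ltW ? ?] := rad01 k.
    apply: (le_trans (normc_le_ReIm _)); rewrite /b /= -[2]/(1 + 1).
    by apply: lerD.
  - have /ae_foralln := dE; apply: circle_aeS2 bE => t [_ _ h] ht.
    have -> : (fun k => sqmod ((bmul (dilation (rad k)) one - bmul b one : L2 R) t)) =
        (fun k => sqmod (dilation (rad k) t - b t)).
      by apply/funext => k; rewrite ht.
    exact: h.
have ip0 k : ip (bmul (dilation (rad k)) one) (zpow R n) = 0.
  have [m nE] : exists m : nat, n = - m.+1%:Z.
    by case: n n0 => // m _; exists m; rewrite NegzE.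
  have me := @expi_mfun R m.+1%:R.
  rewrite -(dilation_coef m (rad01 k)).
  have db := bounded_mfun_L2 (bd k).
  have eb := bounded_mfun_L2 (@expi_mfun R n%:~R).
  transitivity (cintegral (fun t => dilation (rad k) t * conjc (expi (n%:~R * t)))).
    apply: cintegral_ae; [exact: L2integrable|exact: (cintegrable_mul_conj db eb)|].
    have h1 := circle_aeAnd (bmulE one (bd k)) oneE.
    by apply: circle_aeS2 h1 (zpowE R n) => t [e1 e2] e3; rewrite e1 e2 e3 mulr1.
  congr cintegral; apply/funext => t; congr (_ * _).
  by rewrite expi_conj nE mulrNz mulNr opprK.
apply: eq0_normc; apply/eqP; rewrite eq_le normc_nneg andbT.
apply/ler_addgt0Pr => e e0; rewrite add0r.
have /cvgrPdist_lt/(_ _ e0)[k _ /(_ k)] := lim0.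
rewrite /= leqnn sub0r normrN ger0_norm ?hnorm_ge0// => /(_ isT) hk.
have : normc (ip (bmul (dilation (rad k)) one - bmul b one) (zpow R n)) <=
    hnorm (bmul (dilation (rad k)) one - bmul b one) * hnorm (zpow R n).
  by rewrite -lecR; exact: Cauchy_Schwarz.
rewrite ipBl ip0 sub0r normcN hnorm_zpow mulr1 => h.
exact: le_trans h (ltW hk).
Qed.

End boundary_values.

(** * The Hardy space and the backward shift *)

Section hardy_space.
Variable R : realType.
Local Notation mu := (@circle_measure R).
Local Notation one := (zpow R 0).
Implicit Types (f g h p q : L2 R) (n m : int).

(** Integer powers of the shift on L^2; they are unitary, with inverse and adjoint
   given by the opposite exponent. *)
Definition zmul n f : L2 R := bmul (fun t => expi (n%:~R * t)) f.

(* In the context, this discharges the boundedness conditions of bmul lemmas. *)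
Let em n := @expi_mfun R n%:~R.

Lemma zmulD n f g : zmul n (f + g) = zmul n f + zmul n g.
Proof. exact: bmulD. Qed.
Lemma zmulZ n a f : zmul n (a *: f) = a *: zmul n f.
Proof. exact: bmulZ. Qed.
Lemma zmulB n f g : zmul n (f - g) = zmul n f - zmul n g.
Proof. exact: bmulB. Qed.
Lemma zmul_zpow n m : zmul n (zpow R m) = zpow R (n + m).
Proof. exact: bmul_zpow. Qed.

Lemma zmul_zmul n m f : zmul n (zmul m f) = zmul (n + m) f.
Proof.
rewrite /zmul bmulA//; congr bmul; apply/funext => t.
by rewrite -expiD -mulrDl intrD.
Qed.

Lemma zmul0 f : zmul 0 f = f.
Proof.
rewrite /zmul (_ : (fun t => _) = fun=> 1); first by rewrite bmul_cst scale1r.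
by apply/funext => t; rewrite mul0r expi0.
Qed.

Lemma zmulNK n f : zmul n (zmul (- n) f) = f.
Proof. by rewrite zmul_zmul subrr zmul0. Qed.

Lemma mulz_zmul f : mulz f = zmul 1 f.
Proof.
by rewrite mulz_bmul /zmul; congr bmul; apply/funext => t; rewrite mul1r.
Qed.

Lemma ip_zmul n f g : ip (zmul n f) g = ip f (zmul (- n) g).
Proof.
rewrite /zmul ip_bmul//; congr (ip f (bmul _ g)); apply/funext => t.
by rewrite expi_conj mulrNz mulNr.
Qed.

Lemma hnorm_zmul n f : hnorm (zmul n f) = hnorm f.
Proof. by apply: hnorm_bmul => //; apply: aeW => t; exact: expiV. Qed.

Lemma hardy_lin (a : R[i]) f g : hardy f -> hardy g -> hardy (a *: f + g).
Proof. by move=> hf hg n n0; rewrite ipDl ipZl hf// hg// mulr0 addr0. Qed.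

Lemma hardyB f g : hardy f -> hardy g -> hardy (f - g).
Proof. by move=> hf hg; rewrite addrC -scaleN1r; exact: hardy_lin. Qed.

Lemma hardy0 : hardy (0 : L2 R).
Proof. by move=> n _; rewrite ip0l. Qed.

Lemma hardy_zpow (k : nat) : hardy (zpow R k%:Z).
Proof.
move=> n n0; rewrite ip_zpow; case: eqVneq => // kn.
by rewrite -kn ltNge in n0.
Qed.

Lemma hardy_zmul (k : nat) f : hardy f -> hardy (zmul k%:Z f).
Proof.
move=> hf n n0; rewrite ip_zmul zmul_zpow; apply: hf.
by apply: le_lt_trans n0; rewrite gerDr oppr_le0.
Qed.

(** The function z f vanishes at the origin. *)
Lemma ip_one_zmul f : hardy f -> ip one (zmul 1 f) = 0.
Proof. by move=> hf; rewrite ipC ip_zmul zmul_zpow hf// conjc0. Qed.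

Inductive analytic_poly : L2 R -> Prop :=
| analytic_poly0 : analytic_poly 0
| analytic_poly_cons (a : R[i]) (k : nat) p :
    analytic_poly p -> analytic_poly (a *: zpow R k%:Z + p).

Lemma hardy_analytic_poly p : analytic_poly p -> hardy p.
Proof.
by elim => [|a k q _ IH]; [exact: hardy0|apply: hardy_lin => //; exact: hardy_zpow].
Qed.

(** The nonnegative frequencies form an analytic polynomial, and Hardy functions
   are orthogonal to the negative ones. *)
Lemma trigpoly_split p : trigpoly p -> exists q r, [/\ p = q + r,
  analytic_poly q & forall f, hardy f -> ip f r = 0].
Proof.
elim => [|a n p' _ [q [r [-> qA rH]]]].
  by exists 0, 0; split; [rewrite addr0|exact: analytic_poly0|move=> f _; rewrite ip0r].
case: n => [k|k].
  exists (a *: zpow R k%:Z + q), r; split => //; first by rewrite addrA.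
  exact: analytic_poly_cons.
exists q, (a *: zpow R (Negz k) + r); split => //; first by rewrite addrCA.
by move=> f hf; rewrite ipDr ipZr rH// hf// mulr0 addr0.
Qed.

(** The negative frequencies of a trigonometric approximant of f are orthogonal to
   f, so that dropping them improves the approximation. *)
Lemma hardy_dense f (e : R) : hardy f -> 0 < e ->
  exists2 q, analytic_poly q & hnorm (f - q) < e.
Proof.
move=> hf e0; have [p pT fp] := trig_closure_L2 f e0.
have [q [r [pE qA rH]]] := trigpoly_split pT; exists q => //.
have hfq : hardy (f - q) by apply: hardyB => //; exact: hardy_analytic_poly.
apply: le_lt_trans fp; rewrite -(@ler_pXn2r _ 2)// ?nnegrE ?hnorm_ge0//.
have -> : f - p = (f - q) + (- r) by rewrite pE opprD addrA.
by rewrite [leRHS]hnorm_pythagoras ?lerDl ?sqr_ge0// ipNr rH// oppr0.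
Qed.

(** The backward shift (f - f(0)) / z: the inner product of f with 1 is f(0). *)
Definition bshift f : L2 R := zmul (-1) (f - ip f one *: one).

Lemma bshift_linear : linear bshift.
Proof.
move=> a f g; rewrite /bshift -zmulZ -zmulD; congr zmul.
by rewrite scalerBr scalerA ipDl ipZl scalerDl opprD addrACA.
Qed.

Lemma bshift0 : bshift 0 = 0.
Proof. by rewrite /bshift ip0l scale0r subrr /zmul bmul0. Qed.

Lemma ip_one_one : ip one one = 1 :> R[i].
Proof. by rewrite ip_zpow. Qed.

(** Removing the component of f along 1 is an orthogonal projection, and
   multiplication by a power of z is isometric. *)
Lemma hnorm_bshift f : hnorm (bshift f) <= hnorm f.
Proof.
rewrite /bshift hnorm_zmul -(@ler_pXn2r _ 2)// ?nnegrE ?hnorm_ge0//.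
have -> : hnorm f ^+ 2 = hnorm ((f - ip f one *: one) + ip f one *: one) ^+ 2 by rewrite subrK.
rewrite hnorm_pythagoras ?lerDl ?sqr_ge0//.
by rewrite ipZr ipBl ipZl ip_one_one mulr1 subrr mulr0.
Qed.

Lemma bshift_zpow (k : nat) : bshift (zpow R k%:Z) = if k is j.+1 then zpow R j%:Z else 0.
Proof.
rewrite /bshift ip_zpow; case: k => [|k].
  by rewrite scale1r subrr /zmul bmul0.
by rewrite scale0r subr0 zmul_zpow; congr zpow; rewrite -addn1 PoszD addrC addrK.
Qed.

(** Only the coefficient of f of index 0 is moved to a negative frequency, and it
   has been subtracted. *)
Lemma hardy_bshift f : hardy f -> hardy (bshift f).
Proof.
move=> hf n n0; rewrite ip_zmul opprK zmul_zpow ipBl ipZl.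
have [->|n1] := eqVneq n (-1); first by rewrite subrr ip_one_one mulr1 subrr.
have n10 : 1 + n < 0 by move: n0 n1; lia.
by rewrite (hf _ n10) (hardy_zpow 0 n10) mulr0 subr0.
Qed.

Lemma hardy_decomp f : f = ip f one *: one + zmul 1 (bshift f).
Proof. by rewrite /bshift (zmulNK 1) addrC subrK. Qed.

Lemma iter_bshift_linear k : linear (iter k bshift).
Proof. by elim: k => [//|k IH] a f g; rewrite !iterS IH bshift_linear. Qed.

Lemma iter_bshift0 k : iter k bshift 0 = 0.
Proof. by elim: k => // k; rewrite iterS => ->; exact: bshift0. Qed.

Lemma iter_bshift_zpow (k j : nat) : (k < j)%N -> iter j bshift (zpow R k%:Z) = 0.
Proof.
elim: k j => [|k IH] [|j]//= kj; rewrite -iterS iterSr bshift_zpow; first exact: iter_bshift0.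
exact: IH.
Qed.

Lemma hnorm_iter_bshift k f : hnorm (iter k bshift f) <= hnorm f.
Proof. by elim: k => // k IH; rewrite iterS (le_trans (hnorm_bshift _)). Qed.

(** The backward shift is nilpotent on each analytic polynomial and contracts the
   error of approximation. *)
Lemma iter_bshift_small f (e : R) : hardy f -> 0 < e ->
  exists k, hnorm (iter k bshift f) < e.
Proof.
move=> hf e0; have [q qA fq] := hardy_dense hf e0.
have [k qk] : exists k, forall j, (k <= j)%N -> iter j bshift q = 0.
  elim: qA => [|a m p _ [k pk]]; first by exists 0%N => j _; exact: iter_bshift0.
  exists (maxn m.+1 k) => j; rewrite geq_max => /andP[mj kj].
  by rewrite iter_bshift_linear pk// iter_bshift_zpow// scaler0 addr0.
exists k; apply: le_lt_trans fq.
have -> : iter k bshift f = iter k bshift (f - q); last exact: hnorm_iter_bshift.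
by rewrite addrC -scaleN1r iter_bshift_linear qk// scaler0 add0r.
Qed.

Section inner_multiplier.
Variable b : R -> R[i].
Hypotheses (bb : bounded_mfun b) (b1 : {ae mu, forall t, b t * conjc (b t) = 1})
  (hb : hardy (bmul b one)).

Lemma bmul_zmul n f : bmul b (zmul n f) = zmul n (bmul b f).
Proof. by rewrite /zmul bmulC. Qed.

(** Multiplication by b maps analytic polynomials into H^2 since b is in H^2, and it
   is isometric, so density extends this to H^2. *)
Lemma hardy_bmul f : hardy f -> hardy (bmul b f).
Proof.
move=> hf n n0.
have poly q : analytic_poly q -> hardy (bmul b q).
  elim => [|a k p _ IH]; first by rewrite bmul0//; exact: hardy0.
  rewrite bmulD// bmulZ//; apply: hardy_lin => //.
  by rewrite -[k%:Z]addr0 -zmul_zpow bmul_zmul; exact: hardy_zmul.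
apply: eq0_normc; apply/eqP; rewrite eq_le normc_nneg andbT.
apply/ler_addgt0Pr => e e0; rewrite add0r.
have [q qA fq] := hardy_dense hf e0.
have -> : ip (bmul b f) (zpow R n) = ip (bmul b (f - q)) (zpow R n).
  by rewrite bmulB// ipBl (poly q qA n n0) subr0.
have h : normc (ip (bmul b (f - q)) (zpow R n)) <=
    hnorm (bmul b (f - q)) * hnorm (zpow R n).
  by rewrite -lecR; exact: Cauchy_Schwarz.
by apply: (le_trans h); rewrite hnorm_zpow mulr1 hnorm_bmul// ltW.
Qed.

End inner_multiplier.

End hardy_space.

(** * Displacement operators and the compressed shift *)

Section displacement.
Variables (R : realType) (theta : R[i] -> R[i]).
Local Notation K := (model_space theta).

Section operator.
Variables A B : K -> K.
Hypotheses (A_lin : linear A) (B_lin : linear B)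
  (A_le : forall f : K, hnorm (A f) <= hnorm f)
  (B_le : forall f : K, hnorm (B f) <= hnorm f).

Lemma displacement_bounded (X : bounded_op theta) :
  (fun f => X f - A (X (B f))) \in bounded_linear_pred (theta := theta).
Proof.
have := valP X; rewrite !inE => -[X_lin [M XM]]; split.
  move=> a f g; rewrite B_lin !X_lin A_lin scalerBr opprD.
  by rewrite !addrA; congr (_ - _); rewrite addrAC.
exists (2 * (M + `|M|)) => f.
apply: (le_trans (hnormD_le (X f) (- model_val (A (X (B f)))))).
rewrite -mulrA ler_wpM2l// mulrDl; apply: lerD; first exact: XM.
rewrite hnorm_opp; apply: (le_trans (A_le _)); apply: (le_trans (XM _)).
apply: (@le_trans _ _ (`|M| * hnorm (B f))).
  by rewrite ler_wpM2r ?hnorm_ge0// ler_norm.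
by rewrite ler_wpM2l.
Qed.

(** Both D_T and D_H have this form, with B the adjoint of the compressed shift. *)
Definition displacement (X : bounded_op theta) : bounded_op theta :=
  MkBoundedOp (displacement_bounded X).

Lemma displacementE X f : displacement X f = X f - A (X (B f)).
Proof. by []. Qed.

Lemma bounded_op_inj (X Y : bounded_op theta) : (forall f, X f = Y f) -> X = Y.
Proof. by move=> XY; apply: val_inj; apply/funext. Qed.

Lemma displacement_linear : linear displacement.
Proof.
move=> a X Y; apply: bounded_op_inj => f.
rewrite displacementE.
have E (Z T : bounded_op theta) g : (a *: Z + T) g = a *: Z g + T g by [].
rewrite !E !displacementE A_lin scalerBr opprD addrACA//.
Qed.

HB.instance Definition _ := GRing.isLinear.Build R[i] (bounded_op theta)
  (bounded_op theta) *:%R displacement displacement_linear.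

(** If Z = A Z B then Z = A^n Z B^n; A^n is a contraction and B^n f tends to 0, so
   the norm of Z f is arbitrarily small. *)
Lemma displacement_inj :
  (forall (f : K) (e : R), 0 < e -> exists n, hnorm (iter n B f) < e) ->
  injective displacement.
Proof.
move=> B0 X Y XY; pose Z := X - Y.
suff Z0 f : Z f = 0.
  apply: bounded_op_inj => f; apply/eqP; rewrite -subr_eq0; apply/eqP.
  exact: Z0.
have ZAB g : Z g = A (Z (B g)).
  have DZ : displacement Z = 0.
    by rewrite /Z linearB; apply/eqP; rewrite subr_eq0; apply/eqP; exact: XY.
  have : displacement Z g = 0 by rewrite DZ.
  by rewrite displacementE => /eqP; rewrite subr_eq0 => /eqP.
have Zn n g : Z g = iter n A (Z (iter n B g)).
  by elim: n g => // n IH g; rewrite iterSr (iterS n B) -ZAB -IH.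
have An n g : hnorm (iter n A g) <= hnorm g.
  by elim: n => // n IH; rewrite iterS (le_trans (A_le _)).
have := valP Z; rewrite inE => -[_ [M ZM]].
apply: val_inj; apply: hnorm_eq0; apply/eqP; rewrite eq_le hnorm_ge0 andbT.
apply/ler_addgt0Pr => e e0; rewrite add0r.
have e1 : 0 < e / (`|M| + 1) by rewrite divr_gt0// ltr_pwDr.
have [n hn] := B0 f _ e1.
rewrite [val _](congr1 val (Zn n f)).
apply: (le_trans (An n _)); apply: (le_trans (ZM _)).
apply: (@le_trans _ _ ((`|M| + 1) * (e / (`|M| + 1)))); last first.
  by rewrite mulrC divfK// gt_eqF// ltr_pwDr.
apply: (@le_trans _ _ ((`|M| + 1) * hnorm (iter n B f))).
  by rewrite ler_wpM2r ?hnorm_ge0// (le_trans (ler_norm _))// lerDl.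
by rewrite ler_wpM2l ?(ltW hn)// addr_ge0.
Qed.

End operator.

End displacement.

Section compressed_shift.
Variables (R : realType) (theta : R[i] -> R[i]).
Local Notation mu := (@circle_measure R).
Local Notation one := (zpow R 0).
Local Notation K := (model_space theta).
Variable b : R -> R[i].
Hypotheses (bb : bounded_mfun b) (b1 : {ae mu, forall t, b t * conjc (b t) = 1})
  (hb : hardy (bmul b one))
  (b_theta : {ae mu, forall t, b t = radial_limit theta t}).

(** The definition of the model space refers to the radial limit of theta; any
   representative b of its boundary values may replace it. *)
Lemma model_predP (f : L2 R) : f \in model_pred theta <->
  hardy f /\ forall h : L2 R, hardy h -> ip f (bmul b h) = 0.
Proof.
rewrite inE; split=> -[hf kf]; split=> //.
  move=> h hh; apply: kf; exists h => //.
  by apply: circle_aeS2 (bmulE h bb) b_theta => t -> ->.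
move=> g [h hh gE]; rewrite (_ : g = bmul b h); first exact: kf.
apply/L2eqP; apply: circle_aeS2 gE (circle_aeAnd (bmulE h bb) b_theta).
by move=> t -> [-> ->].
Qed.

Lemma model_hardy (f : K) : hardy f.
Proof. by have /model_predP[] := valP f. Qed.

Lemma model_ortho (f : K) (h : L2 R) : hardy h -> ip f (bmul b h) = 0.
Proof. by have /model_predP[_ +] := valP f; apply. Qed.

(* theta itself, as an element of H^2 *)
Local Notation tb := (bmul b one).

Lemma ip_bmul_one h : hardy h -> ip tb (zmul 1 (bmul b h)) = 0.
Proof. by move=> hh; rewrite -bmul_zmul// ip_bmul_unimodular// ip_one_zmul. Qed.

Lemma hardy_one : hardy one.
Proof. exact: (@hardy_zpow R 0). Qed.

(** theta H^2 is the orthogonal sum of C theta and z theta H^2, and z f is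
   orthogonal to the second summand since f is orthogonal to theta H^2. *)
Lemma shift_subproof (f : K) :
  zmul 1 f - ip (zmul 1 f) tb *: tb \in model_pred theta.
Proof.
apply/model_predP; set c := ip (zmul 1 f) tb.
have hz : hardy (zmul 1 f) by apply: (@hardy_zmul R 1); exact: model_hardy.
split; first by rewrite addrC -scaleNr; exact: hardy_lin.
move=> h hh; have hB := hardy_bshift hh.
rewrite (hardy_decomp h) bmulD// bmulZ// bmul_zmul// ipBl ipZl !ipDr !ipZr.
rewrite ip_bmul_one// ip_bmul_unimodular// ip_one_one -/c.
rewrite ip_zmul zmul_zmul addNr zmul0 model_ortho// !addr0 mulr1.
by rewrite mulrC subrr.
Qed.

Definition shift_op (f : K) : K := MkModel (shift_subproof f).

(** For h in H^2 the function z theta h is in theta H^2, hence orthogonal to f, and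
   it vanishes at the origin, hence is orthogonal to f(0). *)
Lemma bshift_subproof (f : K) : bshift f \in model_pred theta.
Proof.
apply/model_predP; have hf := model_hardy f; split; first exact: hardy_bshift.
move=> h hh; rewrite /bshift ip_zmul opprK ipBl ipZl.
rewrite ip_one_zmul ?mulr0 ?subr0; last exact: hardy_bmul.
by rewrite -bmul_zmul// model_ortho//; exact: (@hardy_zmul R 1).
Qed.

Definition bshift_op (f : K) : K := MkModel (bshift_subproof f).

Lemma ip_model_eq0 (g : K) : (forall k : K, ip g k = 0) -> g = 0.
Proof.
by move=> g0; apply: val_inj; apply/eqP; rewrite -(dnorm_eq0 (@ip R)); apply/eqP; exact: g0.
Qed.

Lemma ip_tb (k : K) : ip tb k = 0.
Proof. by rewrite ipC model_ortho ?conjc0//; exact: hardy_one. Qed.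

(** The difference of z f and the candidate is a multiple of theta, which is
   orthogonal to the model space; this determines the projection. *)
Lemma compressed_shiftE : compressed_shift theta = shift_op.
Proof.
apply/funext => f; rewrite /compressed_shift /model_proj mulz_zmul.
set P := [set g : K | _].
have PS : P (shift_op f).
  by move=> k /=; rewrite opprB addrC subrK ipZl ip_tb mulr0.
have PP := xgetI 0 PS; apply/eqP; rewrite -subr_eq0; apply/eqP.
apply: ip_model_eq0 => k.
pose G := model_val (xget 0 P); pose S := model_val (shift_op f).
have -> : ip (model_val (xget 0 P - shift_op f)) k = ip (G - S) k by [].
have E (x y z : L2 R) : y - x = (z - x) - (z - y).
  by rewrite opprB [RHS]addrC addrA subrK.
by rewrite (E S G (zmul 1 f)) ipBl PS PP subrr.
Qed.

(** On the model space <S f, g> = <z f, g> since theta is orthogonal to g, and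
   <f, B g> = <z f, g - g(0)> = <z f, g> since z f vanishes at the origin. *)
Lemma adjoint_compressed_shiftE : adjoint (compressed_shift theta) = bshift_op.
Proof.
rewrite compressed_shiftE /adjoint; set P := [set B : K -> K | _].
have PB : P bshift_op.
  move=> f g; rewrite /= ipBl ipZl ip_tb mulr0 subr0 ip_zmul /bshift zmulB ipBr.
  rewrite zmulZ zmul_zpow ipZr (model_hardy f) ?mulr0 ?subr0//.
have PP := xgetI (fun=> 0) PB.
apply/funext => g; apply/eqP; rewrite -subr_eq0; apply/eqP.
apply: ip_model_eq0 => k; rewrite ipC.
have -> : ip k (xget 0 P g - bshift_op g : K) = ip k (xget 0 P g) - ip k (bshift_op g).
  exact: ipBr.
by rewrite -PB -PP subrr conjc0.
Qed.

Lemma shift_op_linear : linear shift_op.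
Proof.
move=> a f g; apply: val_inj.
change (zmul 1 (a *: model_val f + model_val g) -
    ip (zmul 1 (a *: model_val f + model_val g)) tb *: tb =
  a *: (zmul 1 f - ip (zmul 1 f) tb *: tb) + (zmul 1 g - ip (zmul 1 g) tb *: tb)).
rewrite zmulD zmulZ ipDl ipZl scalerDl -scalerA scalerBr opprD.
by rewrite addrACA.
Qed.

Lemma bshift_op_linear : linear bshift_op.
Proof. by move=> a f g; apply: val_inj; exact: bshift_linear. Qed.

Lemma hnorm_shift_op (f : K) : hnorm (shift_op f) <= hnorm f.
Proof.
rewrite -(hnorm_zmul 1 f) -(@ler_pXn2r _ 2)// ?nnegrE ?hnorm_ge0//.
set c := ip (zmul 1 f) tb.
have -> : zmul 1 f = model_val (shift_op f) + c *: tb by rewrite /= subrK.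
rewrite [leRHS]hnorm_pythagoras ?lerDl ?sqr_ge0//.
by rewrite ipZr model_ortho ?mulr0//; exact: hardy_one.
Qed.

Lemma iter_bshift_op n (f : K) : model_val (iter n bshift_op f) = iter n (@bshift R) f.
Proof. by elim: n => // n IH; rewrite !iterS /= IH. Qed.

End compressed_shift.

Theorem lemma5p3 (R : realType) (theta : R[i] -> R[i])
    (theta_inner : inner theta)
    (theta_nonconst : ~ exists c : R[i], forall z, `|z| < 1 -> theta z = c) :
  exists D_T D_H : {linear bounded_op theta -> bounded_op theta},
    [/\ forall (X : bounded_op theta) (f : model_space theta),
          D_T X f = X f - compressed_shift theta
                            (X (adjoint (compressed_shift theta) f)),
        forall (X : bounded_op theta) (f : model_space theta),
          D_H X f = X f - adjoint (compressed_shift theta)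
                            (X (adjoint (compressed_shift theta) f)),
        injective D_T
      & injective D_H].
Proof.
have [b [bb b_theta b1 hb]] := boundary_function theta_inner.
have SE := compressed_shiftE bb b1 hb b_theta.
have BE := adjoint_compressed_shiftE bb b1 hb b_theta.
rewrite BE SE.
set S := shift_op _ _ _ _; set B := bshift_op _ _ _ _.
have S_lin : linear S by exact: shift_op_linear.
have B_lin : linear B by exact: bshift_op_linear.
have S_le f : hnorm (S f) <= hnorm f by exact: hnorm_shift_op.
have B_le f : hnorm (B f) <= hnorm f by exact: hnorm_bshift.
have B0 (f : model_space theta) (e : R) : 0 < e -> exists n, hnorm (iter n B f) < e.
  move=> e0; have [n hn] := iter_bshift_small (model_hardy bb b_theta f) e0.
  by exists n; rewrite iter_bshift_op.
exists (displacement S_lin B_lin S_le B_le), (displacement B_lin B_lin B_le B_le).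
split=> //; exact: displacement_inj.
Qed.
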